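(* Let $\chi$ be a Dirichlet character modulo $m$ with associated Dirichlet $L$-function $L_\chi$. For every integer $n\ge0$, $L_\chi'(-n)$ is an exponential period over the field $\mathbb{Q}(\chi)(t,e^{-t})$.
   Context: $L_\chi(s)=\sum_{k\ge1}\chi(k)k^{-s}$ for $\Re s>1$, continued meromorphically to $\mathbb{C}$. $\mathbb{Q}(\chi)$ is the field generated over $\mathbb{Q}$ by the values of $\chi$, and $\mathbb{Q}(\chi)(t,e^{-t})$ is the field of meromorphic functions of $t$ generated over it by $t$ and $e^{-t}$. A complex number is an exponential period over a field $\mathbb{F}$ of meromorphic functions of $t$ if it equals a convergent integral $\int_0^{+\infty}f(t)\,dt$ with $f\in\mathbb{F}$. *)

(* Defs.v *)
(* Stdlib reals, with Coquelicot for complex numbers, power series, complex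
   derivatives and improper Riemann integrals. *)
From Stdlib Require Import Reals ZArith Znumtheory.
From Coquelicot Require Import Coquelicot.

Open Scope C_scope.

Definition Cexp (z : C) : C :=
  (exp (fst z) * cos (snd z), exp (fst z) * sin (snd z))%R.

(* [k ^ s] for an integer [k >= 1] and a complex exponent [s], with the real
   logarithm of [k]. *)
Definition nat_Cpower (k : nat) (s : C) : C := Cexp (s * RtoC (ln (INR k))).

(* A character of the group of units modulo [m], extended by zero to the
   integers not coprime to [m] and viewed as a function on [Z]. *)
Record dirichlet_character (m : Z) (chi : Z -> C) : Prop := {
  dc_periodic : forall a : Z, chi (a + m)%Z = chi a;
  dc_one : chi 1%Z = 1;
  dc_mul : forall a b : Z, chi (a * b)%Z = chi a * chi b;
  dc_support : forall a : Z, chi a <> 0 <-> rel_prime a m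
}.

Definition analytic_at (f : C -> C) (z : C) : Prop :=
  exists a : nat -> C, locally z (fun w => is_pseries a (w - z) (f w)).

(* A Laurent expansion around [z] with finite principal part.  The value of [f]
   at [z] itself is irrelevant. *)
Definition meromorphic_at (f : C -> C) (z : C) : Prop :=
  exists (k : nat) (a : nat -> C),
    locally' z (fun w => is_pseries a (w - z) (Cpow (w - z) k * f w)).

(* A genuine pole, of order [S k]. *)
Definition pole_at (f : C -> C) (z : C) : Prop :=
  exists (k : nat) (a : nat -> C),
    a 0%nat <> 0 /\
    locally' z (fun w => is_pseries a (w - z) (Cpow (w - z) (S k) * f w)).

(* [L] is the meromorphic continuation to [C] of the Dirichlet series of [chi].
   [L] is required to be analytic wherever it has no pole, so that it takes the
   right value at removable singularities; only its values at its poles are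
   left unspecified. *)
Record dirichlet_L (chi : Z -> C) (L : C -> C) : Prop := {
  dL_meromorphic : forall s : C, analytic_at L s \/ pole_at L s;
  dL_series : forall s : C, (1 < fst s)%R ->
    is_series (fun j => chi (Z.of_nat (S j)) * nat_Cpower (S j) (- s)) (L s)
}.

Record subfield (K : C -> Prop) : Prop := {
  sf_one : K 1;
  sf_sub : forall x y, K x -> K y -> K (x - y);
  sf_mul : forall x y, K x -> K y -> K (x * y);
  sf_inv : forall x, K x -> x <> 0 -> K (/ x)
}.

(* The field generated over the rationals by the values of [chi]; a subfield of
   [C] automatically contains the rationals. *)
Definition Q_adjoin_values (chi : Z -> C) (x : C) : Prop :=
  forall K : C -> Prop, subfield K -> (forall a : Z, K (chi a)) -> K x.

(* Meromorphic functions on [C] are represented by total functions, up to their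
   values on a closed discrete set; pointwise operations are then the
   operations of the field of meromorphic functions. *)
Definition meromorphic (f : C -> C) : Prop := forall z : C, meromorphic_at f z.

Definition mero_eq (f g : C -> C) : Prop :=
  forall z : C, locally' z (fun w => f w = g w).

Record mero_subfield (F : (C -> C) -> Prop) : Prop := {
  msf_meromorphic : forall f, F f -> meromorphic f;
  msf_eq : forall f g, F f -> mero_eq f g -> F g;
  msf_one : F (fun _ => 1);
  msf_sub : forall f g, F f -> F g -> F (fun t => f t - g t);
  msf_mul : forall f g, F f -> F g -> F (fun t => f t * g t);
  msf_inv : forall f, F f -> ~ mero_eq f (fun _ => 0) -> F (fun t => / f t)
}.

(* [K (t, e^{-t})], the field of meromorphic functions of [t] generated over [K]
   by [t] and [e^{-t}]. *)
Definition field_t_exp (K : C -> Prop) (f : C -> C) : Prop :=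
  forall F : (C -> C) -> Prop,
    mero_subfield F ->
    (forall c : C, K c -> F (fun _ => c)) ->
    F (fun t => t) ->
    F (fun t => Cexp (- t)) ->
    F f.

(* The integral is improper at both ends, so that it does not depend on the
   value representing [f] at [0]. *)
Definition exponential_period (F : (C -> C) -> Prop) (z : C) : Prop :=
  exists f : C -> C, F f /\
    is_RInt_gen (V := C_R_NormedModule) (fun t : R => f (RtoC t))
      (at_right 0) (Rbar_locally p_infty) z.

(* Main.v *)
(* Fix a residue [b] and write [F(t) = exp(-(b+1)t) / (1 - exp(-mt))].  Near 0,
   [t exp(t) F(t)] has a Taylor expansion with rational coefficients [beta_j];
   let [h] be [exp(-t)] times the remainder of order [p + 1 = n + 2], divided by
   [t^(p+1)], so that [h] is bounded by a multiple of [exp(-t)] on the whole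
   half-line.  Taking Mellin transforms, for [s > 1],
   [Gamma(s) sum_i (b+1+mi)^(-s) = sum_j beta_j Gamma(s-1+j) + M_h(s+p)],
   where [M_h] is the Mellin transform of [h], analytic on [s > 0].  Dividing by
   [Gamma(s)] turns the sum into a polynomial over [s - 1] and [1/Gamma(s)] into
   [s(s+1)...(s+n) / Gamma(s+p)], which has a simple zero at [s = -n].  Hence the
   derivative at [-n] is a rational number plus a rational multiple of
   [M_h(1) = int_0^oo h], and the rational number is itself its product with
   [int_0^oo exp(-t)].

   The function [L] is identified with this continuation by working on the real
   axis only: the real and imaginary parts of [L] have Laurent expansions at
   every real point, and the identity theorem is propagated from [s > 1] to the
   left, through the possible pole at 1.  A pole at [-n] is excluded because
   the continuation is continuous there. *)

Require Import Defs.
From Stdlib Require Import Reals ZArith Znumtheory Lra Lia Classical.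
From Coquelicot Require Import Coquelicot.

Local Open Scope R_scope.

(** * Integrals over the positive half-line *)

(** Pulling out [exp (- t)] before expanding makes each Taylor term a Gamma integral over the whole
    half-line, so no integral over a bounded interval appears. The choice [p = n + 1] puts
    [s + p = 1] at [s = - n]: the Mellin kernel becomes the constant 1, so that [M_h(1)] is the
    plain integral of [h], and [Gamma(1) = 1]. The zero of the cofactor is what makes the result a
    period over this field: the derivatives of [M_h] and [Gamma] would bring [ln t] into the
    integrand, but they are multiplied by 0, and only their existence matters. Limits and integrals
    are exchanged through explicit error bounds, each itself a Gamma integral. Quotients of power
    series are avoided: denominators are cleared both when the Taylor coefficients are computed and
    when the identity theorem is applied. The real axis only determines the first coefficient of the
    expansion of [L] at [- n]; that this coefficient is the complex derivative is a separate
    estimate on power series. *)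

Definition integral0oo (f : R -> R) (l : R) : Prop :=
  is_RInt_gen f (at_right 0) (Rbar_locally p_infty) l.

Definition cont_pos (f : R -> R) : Prop := forall t, 0 < t -> continuous f t.

Lemma ends_filter_intro (P : R * R -> Prop) (a0 b0 : R) :
  0 < a0 -> (forall a b, 0 < a < a0 -> b0 < b -> P (a, b)) ->
  filter_prod (at_right 0) (Rbar_locally p_infty) P.
Proof.
  intros Ha H.
  apply Filter_prod with (fun a => 0 < a < a0) (fun b => b0 < b).
  - exists (mkposreal a0 Ha). intros y Hy Hy0.
    unfold ball in Hy; simpl in Hy; unfold AbsRing_ball, abs, minus, plus, opp in Hy; simpl in Hy.
    apply Rabs_def2 in Hy. lra.
  - exists b0. auto.
  - intros a b Ha' Hb. apply H; auto.
Qed.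

Lemma ends_filter_elim (P : R * R -> Prop) :
  filter_prod (at_right 0) (Rbar_locally p_infty) P ->
  exists a0 b0, 0 < a0 < b0 /\ forall a b, 0 < a < a0 -> b0 < b -> P (a, b).
Proof.
  intros [Q S [d HQ] [B HS] H].
  exists d, (Rmax B (d + 1)).
  assert (Hd := cond_pos d).
  assert (HB := Rmax_l B (d + 1)). assert (HB' := Rmax_r B (d + 1)).
  split; [lra|].
  intros a b Ha Hb. apply H.
  - apply HQ; [|lra].
    unfold ball; simpl; unfold AbsRing_ball, abs, minus, plus, opp; simpl.
    apply Rabs_def1; lra.
  - apply HS; lra.
Qed.

Lemma ex_RInt_pos (f : R -> R) (a b : R) :
  cont_pos f -> 0 < a -> 0 < b -> ex_RInt f a b.
Proof.
  intros Hf Ha Hb. apply (ex_RInt_continuous (V := R_CompleteNormedModule)).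
  intros z Hz. apply Hf.
  assert (0 < Rmin a b) by (apply Rmin_glb_lt; lra). lra.
Qed.

Lemma integral0oo_intro (f : R -> R) (l : R) :
  cont_pos f ->
  (forall eps : posreal, exists a0 b0, 0 < a0 < b0 /\
     forall a b, 0 < a < a0 -> b0 < b -> Rabs (RInt f a b - l) < eps) ->
  integral0oo f l.
Proof.
  intros Hf H P [eps HP].
  destruct (H eps) as (a0 & b0 & Hab & HR).
  unfold filtermapi.
  apply ends_filter_intro with a0 b0; [lra|].
  intros a b Ha Hb. exists (RInt f a b). split.
  - apply (RInt_correct (V := R_CompleteNormedModule)). apply ex_RInt_pos; auto; simpl; lra.
  - apply HP. apply (HR a b Ha Hb).
Qed.

Lemma integral0oo_elim (f : R -> R) (l : R) :
  integral0oo f l ->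
  (forall eps : posreal, exists a0 b0, 0 < a0 < b0 /\
     forall a b, 0 < a < a0 -> b0 < b -> Rabs (RInt f a b - l) < eps).
Proof.
  intros H eps.
  destruct (ends_filter_elim _ (H (fun y => ball l eps y) (locally_ball l eps)))
    as (a0 & b0 & Hab & HR).
  exists a0, b0. split; [exact Hab|]. intros a b Ha Hb.
  destruct (HR a b Ha Hb) as (y & Hy & Hb').
  simpl in Hy. rewrite (is_RInt_unique (V := R_CompleteNormedModule) _ _ _ _ Hy).
  exact Hb'.
Qed.

Lemma ends_proper :
  ProperFilter (filter_prod (at_right 0) (Rbar_locally p_infty)).
Proof. apply filter_prod_proper; typeclasses eauto. Qed.

Lemma integral0oo_unique (f : R -> R) (l l' : R) :
  integral0oo f l -> integral0oo f l' -> l = l'.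
Proof.
  intros H H'.
  transitivity (RInt_gen f (at_right 0) (Rbar_locally p_infty)).
  - symmetry. apply (is_RInt_gen_unique (V := R_CompleteNormedModule)). exact H.
  - apply (is_RInt_gen_unique (V := R_CompleteNormedModule)). exact H'.
Qed.

Lemma integral0oo_RInt_gen (f : R -> R) :
  (exists l, integral0oo f l) ->
  integral0oo f (RInt_gen f (at_right 0) (Rbar_locally p_infty)).
Proof.
  intros [l H].
  assert (E : RInt_gen f (at_right 0) (Rbar_locally p_infty) = l)
    by (apply (is_RInt_gen_unique (V := R_CompleteNormedModule)); exact H).
  rewrite E. exact H.
Qed.

Lemma integral0oo_ext (f g : R -> R) (l : R) :
  (forall t, 0 < t -> f t = g t) -> integral0oo f l -> integral0oo g l.
Proof.
  intros H. apply (is_RInt_gen_ext (Fa := at_right 0) (Fb := Rbar_locally p_infty) f g l).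
  apply ends_filter_intro with 1 1; [lra|]. intros a b Ha Hb x Hx. simpl in Hx.
  apply H. rewrite Rmin_left in Hx; lra.
Qed.

Lemma integral0oo_plus (f g : R -> R) (l l' : R) :
  integral0oo f l -> integral0oo g l' -> integral0oo (fun t => f t + g t) (l + l').
Proof. intros H H'. apply (is_RInt_gen_plus f g l l' H H'). Qed.

Lemma integral0oo_minus (f g : R -> R) (l l' : R) :
  integral0oo f l -> integral0oo g l' -> integral0oo (fun t => f t - g t) (l - l').
Proof. intros H H'. apply (is_RInt_gen_minus f g l l' H H'). Qed.

Lemma integral0oo_scal (k : R) (f : R -> R) (l : R) :
  integral0oo f l -> integral0oo (fun t => k * f t) (k * l).
Proof. intros H. apply (is_RInt_gen_scal f k l H). Qed.

Lemma integral0oo_sum (f : nat -> R -> R) (l : nat -> R) (N : nat) :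
  (forall i, (i <= N)%nat -> integral0oo (f i) (l i)) ->
  integral0oo (fun t => sum_n (fun i => f i t) N) (sum_n l N).
Proof.
  induction N as [|N IH]; intros H.
  - rewrite sum_O. apply integral0oo_ext with (f 0%nat); [|apply H; lia].
    intros. now rewrite sum_O.
  - rewrite sum_Sn.
    apply integral0oo_ext with (fun t => sum_n (fun i => f i t) N + f (S N) t).
    { intros. now rewrite sum_Sn. }
    apply integral0oo_plus; [apply IH; intros; apply H; lia | apply H; lia].
Qed.

Lemma integral0oo_bound (f g : R -> R) (l l' : R) :
  (forall t, 0 < t -> Rabs (f t) <= g t) ->
  integral0oo f l -> integral0oo g l' -> Rabs l <= l'.
Proof.
  intros H Hf Hg.
  apply (RInt_gen_norm (V := R_CompleteNormedModule)
    (Fa := at_right 0) (Fb := Rbar_locally p_infty) f g l l'); auto.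
  - apply ends_filter_intro with 1 1; [lra|]. intros; simpl; lra.
  - apply ends_filter_intro with 1 1; [lra|]. intros a b Ha Hb x Hx; simpl in *.
    apply H; lra.
Qed.

(** Cauchy criterion along growing intervals: two integrals of [f] differ by its integrals over the
    two end pieces, and these are controlled by the integrals of [g] there, which are small because
    [g] converges. *)
Lemma integral0oo_dominated (f g : R -> R) (l : R) :
  cont_pos f -> cont_pos g -> (forall t, 0 < t -> Rabs (f t) <= g t) ->
  integral0oo g l -> exists l', integral0oo f l'.
Proof.
  intros Hf Hg Hle HI.
  assert (Hsub : forall a b, 0 < a <= b -> Rabs (RInt f a b) <= RInt g a b).
  { intros a b Hab.
    apply (norm_RInt_le (V := R_CompleteNormedModule) f g a b); try lra.
    - intros x Hx. apply Hle; lra.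
    - apply (RInt_correct (V := R_CompleteNormedModule)), ex_RInt_pos; auto; lra.
    - apply (RInt_correct (V := R_CompleteNormedModule)), ex_RInt_pos; auto; lra. }
  assert (Hch : forall h a b c, cont_pos h -> 0 < a -> 0 < b -> 0 < c ->
    RInt h a c = RInt h a b + RInt h b c).
  { intros h a b c Hh Ha Hb Hc. symmetry.
    apply (RInt_Chasles (V := R_CompleteNormedModule)); apply ex_RInt_pos; auto. }
  (* The end pieces in the Cauchy estimate may have their bounds in either order, hence the absolute
     value on the right. *)
  assert (Hsub' : forall a b, 0 < a -> 0 < b -> Rabs (RInt f a b) <= Rabs (RInt g a b)).
  { intros a b Ha Hb. destruct (Rle_dec a b) as [Hab|Hab].
    - eapply Rle_trans; [apply Hsub; lra | apply Rle_abs].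
    - rewrite <- (opp_RInt_swap (V := R_CompleteNormedModule) f) by (apply ex_RInt_pos; auto).
      rewrite <- (opp_RInt_swap (V := R_CompleteNormedModule) g) by (apply ex_RInt_pos; auto).
      unfold opp; simpl. rewrite !Rabs_Ropp.
      eapply Rle_trans; [apply Hsub; lra | apply Rle_abs]. }
  destruct (proj1 (filterlim_locally_cauchy (U := R_CompleteSpace)
     (F := filter_prod (at_right 0) (Rbar_locally p_infty)) (FF := ends_proper)
     (fun ab : R * R => RInt f (fst ab) (snd ab)))) as [y Hy].
  - intros eps.
    assert (He := cond_pos eps).
    (* Each of the two end pieces of [g] is a difference of two integrals that are within [eps / 4]
       of [l]. *)
    assert (He4 : 0 < eps / 4) by lra.
    destruct (integral0oo_elim g l HI (mkposreal _ He4)) as (a0 & b0 & Hab & H).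
    exists (fun ab : R * R => 0 < fst ab < a0 /\ b0 < snd ab). split.
    { apply ends_filter_intro with a0 b0; [lra|]. simpl; auto. }
    intros [a b] [a' b'] [Ha Hb] [Ha' Hb']; simpl in *.
    unfold ball; simpl; unfold AbsRing_ball, abs, minus, plus, opp; simpl.
    assert (H1 := H a b Ha Hb). assert (H2 := H a' b' Ha' Hb'). assert (H3 := H a' b Ha' Hb).
    assert (E1 : RInt f a' b' + - RInt f a b = RInt f a' a + RInt f b b').
    { rewrite (Hch f a' a b'), (Hch f a b b'); auto; lra. }
    rewrite E1.
    assert (G1 := Hch g a' a b Hg ltac:(lra) ltac:(lra) ltac:(lra)).
    assert (G2 := Hch g a' b b' Hg ltac:(lra) ltac:(lra) ltac:(lra)).
    assert (K1 := Hsub' a' a ltac:(lra) ltac:(lra)).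
    assert (K2 := Hsub' b b' ltac:(lra) ltac:(lra)).
    assert (Rabs (RInt g a' a) < eps / 2).
    { replace (RInt g a' a) with ((RInt g a' b - l) - (RInt g a b - l)) by lra.
      eapply Rle_lt_trans; [apply Rabs_triang|]. rewrite Rabs_Ropp. lra. }
    assert (Rabs (RInt g b b') < eps / 2).
    { replace (RInt g b b') with ((RInt g a' b' - l) - (RInt g a' b - l)) by lra.
      eapply Rle_lt_trans; [apply Rabs_triang|]. rewrite Rabs_Ropp. lra. }
    eapply Rle_lt_trans; [apply Rabs_triang|]. lra.
  - exists y. apply integral0oo_intro; [exact Hf|].
    intros eps.
    assert (Hy' := Hy (ball y eps) (locally_ball y eps)).
    destruct (ends_filter_elim _ Hy') as (a0 & b0 & Hab & H).
    exists a0, b0. split; [exact Hab|]. intros a b Ha Hb. apply (H a b Ha Hb).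
Qed.

Lemma integral0oo_antiderivative (F f : R -> R) (la lb : R) :
  (forall t, 0 < t -> is_derive F t (f t)) -> cont_pos f ->
  filterlim F (at_right 0) (locally la) ->
  filterlim F (Rbar_locally p_infty) (locally lb) ->
  integral0oo f (lb - la).
Proof.
  intros HF Hf Ha Hb.
  apply integral0oo_ext with (Derive F).
  { intros t Ht. apply is_derive_unique, HF, Ht. }
  apply (is_RInt_gen_Derive (Fa := at_right 0) (Fb := Rbar_locally p_infty) F la lb); auto.
  - apply ends_filter_intro with 1 1; [lra|]. intros a b Ha' Hb' x Hx; simpl in *.
    rewrite Rmin_left in Hx by lra. exists (f x). apply HF; lra.
  - apply ends_filter_intro with 1 1; [lra|]. intros a b Ha' Hb' x Hx; simpl in *.
    rewrite Rmin_left in Hx by lra.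
    apply continuous_ext_loc with f.
    + assert (0 < x) by lra. exists (mkposreal _ H). intros y Hy.
      unfold ball in Hy; simpl in Hy; unfold AbsRing_ball, abs, minus, plus, opp in Hy; simpl in Hy.
      apply Rabs_def2 in Hy. symmetry. apply is_derive_unique, HF. lra.
    + apply Hf; lra.
Qed.

Lemma integral0oo_comp_scal (f : R -> R) (k l : R) :
  0 < k -> cont_pos f -> integral0oo f l -> integral0oo (fun t => f (k * t)) (l / k).
Proof.
  intros Hk Hf H.
  assert (Hc : cont_pos (fun t => f (k * t))).
  { intros t Ht. apply continuous_comp.
    - apply (continuous_scal_r (V := R_NormedModule) k (fun t => t)). apply continuous_id.
    - apply Hf. nra. }
  apply integral0oo_intro; [exact Hc|]. intros eps.
  assert (Hke : 0 < k * eps) by (apply Rmult_lt_0_compat; [lra|apply cond_pos]).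
  destruct (integral0oo_elim f l H (mkposreal _ Hke)) as (a0 & b0 & Hab & HR).
  exists (a0 / k), (b0 / k). split.
  { unfold Rdiv. assert (0 < / k) by (apply Rinv_0_lt_compat; lra). nra. }
  intros a b Ha Hb.
  assert (Ha' : 0 < k * a < a0).
  { split; [nra|]. replace a0 with (k * (a0 / k)) by (field; lra). nra. }
  assert (Hb' : b0 < k * b).
  { replace b0 with (k * (b0 / k)) by (field; lra). nra. }
  assert (E := HR _ _ Ha' Hb').
  assert (E2 : RInt (fun t => f (k * t)) a b = / k * RInt f (k * a) (k * b)).
  { assert (E3 := is_RInt_comp_lin (V := R_CompleteNormedModule) f k 0 a b (RInt f (k * a) (k * b))).
    rewrite !Rplus_0_r in E3.
    assert (E4 := is_RInt_scal (V := R_CompleteNormedModule) _ _ _ (/ k) _ (E3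
      (RInt_correct (V := R_CompleteNormedModule) f _ _
        (ex_RInt_pos f _ _ Hf (proj1 Ha') (Rlt_trans _ _ _ (Rlt_trans _ _ _ (proj1 Hab) (proj2 Hab)) Hb'))))).
    apply (is_RInt_unique (V := R_CompleteNormedModule)).
    eapply (is_RInt_ext (V := R_CompleteNormedModule)); [|exact E4].
    intros x _. cbv beta. rewrite Rplus_0_r. unfold scal; simpl; unfold mult; simpl. field. lra. }
  rewrite E2. replace (/ k * RInt f (k * a) (k * b) - l / k) with (/ k * (RInt f (k * a) (k * b) - l)) by (field; lra).
  rewrite Rabs_mult, Rabs_pos_eq by (apply Rlt_le, Rinv_0_lt_compat; lra).
  simpl in E. apply Rmult_lt_reg_l with k; [lra|].
  rewrite <- Rmult_assoc, Rinv_r, Rmult_1_l by lra. exact E.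
Qed.

(** * The Gamma function *)

Definition mellin (h : R -> R) (s : R) : R :=
  RInt_gen (fun t => Rpower t (s - 1) * h t) (at_right 0) (Rbar_locally p_infty).

Lemma is_derive_Rpower (s t : R) :
  0 < t -> is_derive (fun t => Rpower t s) t (s * Rpower t (s - 1)).
Proof.
  intros Ht. unfold Rpower.
  replace (s * exp ((s - 1) * ln t)) with (s * / t * exp (s * ln t)).
  - auto_derive; [lra|]. ring.
  - replace (s * ln t) with (ln t + (s - 1) * ln t) by ring.
    rewrite exp_plus, exp_ln by lra. field. lra.
Qed.

Lemma cont_pos_Rpower (s : R) : cont_pos (fun t => Rpower t s).
Proof.
  intros t Ht. apply (ex_derive_continuous (V := R_NormedModule)).
  eexists. apply is_derive_Rpower, Ht.
Qed.

Lemma cont_pos_mult (f g : R -> R) :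
  cont_pos f -> cont_pos g -> cont_pos (fun t => f t * g t).
Proof. intros Hf Hg t Ht. apply (continuous_mult (K := R_AbsRing) f g); auto. Qed.

Lemma cont_pos_plus (f g : R -> R) :
  cont_pos f -> cont_pos g -> cont_pos (fun t => f t + g t).
Proof. intros Hf Hg t Ht. apply (continuous_plus (V := R_NormedModule) f g); auto. Qed.

Lemma cont_pos_const (c : R) : cont_pos (fun _ => c).
Proof. intros t Ht. apply continuous_const. Qed.

Lemma cont_pos_expN : cont_pos (fun t => exp (- t)).
Proof.
  intros t Ht. apply (ex_derive_continuous (V := R_NormedModule)).
  auto_derive. exact I.
Qed.

Lemma Rpower_pos (t s : R) : 0 < Rpower t s.
Proof. apply exp_pos. Qed.

Lemma filterlim_at_right_0 (F : R -> R) (s : R) :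
  0 < s -> (forall t, 0 < t -> Rabs (F t) <= Rpower t s) ->
  filterlim F (at_right 0) (locally 0).
Proof.
  intros Hs HF P [eps HP].
  assert (He : 0 < Rpower eps (/ s)) by apply Rpower_pos.
  exists (mkposreal _ He). intros y Hy Hy0.
  unfold ball in Hy; simpl in Hy; unfold AbsRing_ball, abs, minus, plus, opp in Hy; simpl in Hy.
  apply Rabs_def2 in Hy. apply HP.
  unfold ball; simpl; unfold AbsRing_ball, abs, minus, plus, opp; simpl.
  rewrite Ropp_0, Rplus_0_r.
  eapply Rle_lt_trans; [apply HF, Hy0|].
  assert (E : Rpower (Rpower eps (/ s)) s = eps).
  { rewrite Rpower_mult, Rinv_l, Rpower_1; [reflexivity|apply cond_pos|lra]. }
  rewrite <- E.
  apply Rlt_Rpower_l; lra.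
Qed.

Lemma filterlim_p_infty_inv (F : R -> R) (l C : R) :
  (forall t, 0 < t -> Rabs (F t - l) <= C / t) ->
  filterlim F (Rbar_locally p_infty) (locally l).
Proof.
  intros HF P [eps HP].
  exists (Rmax 1 (C / eps)). intros y Hy.
  assert (He := cond_pos eps).
  assert (H1 := Rmax_l 1 (C / eps)). assert (H2 := Rmax_r 1 (C / eps)).
  apply HP.
  unfold ball; simpl; unfold AbsRing_ball, abs, minus, plus, opp; simpl.
  eapply Rle_lt_trans; [apply HF; lra|].
  apply Rmult_lt_reg_r with y; [lra|].
  replace (C / y * y) with C by (field; lra).
  replace C with (eps * (C / eps)) by (field; lra). nra.
Qed.

(** Multiply [ln (t / s) <= t / s] by [s] and exponentiate; the constant is [s ^ s]. *)
Lemma Rpower_le_exp (s t : R) :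
  0 < s -> 0 < t -> Rpower t s <= exp (s * ln s) * exp t.
Proof.
  intros Hs Ht. unfold Rpower. rewrite <- exp_plus.
  assert (ln (t / s) <= t / s).
  { assert (Hp : 0 < t / s) by (apply Rdiv_lt_0_compat; lra).
    rewrite <- (ln_exp (t / s)) at 2.
    apply ln_le; [lra|]. assert (H := exp_ineq1_le (t / s)). lra. }
  rewrite ln_div in H by lra.
  assert (s * (t / s) = t) by (field; lra).
  assert (s * ln t <= s * ln s + t) by nra.
  destruct H1 as [H1|H1]; [left; apply exp_increasing; lra | right; now rewrite H1].
Qed.

(** The exponential bound for the exponent [s + 1] leaves a spare factor [t], which gives the decay
    at infinity. *)
Lemma Rpower_exp_le_inv (s t : R) :
  0 < s -> 0 < t ->
  Rpower t s * exp (- t) <= exp ((s + 1) * ln (s + 1)) / t.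
Proof.
  intros Hs Ht.
  assert (H := Rpower_le_exp (s + 1) t ltac:(lra) Ht).
  rewrite Rpower_plus, Rpower_1 in H by lra.
  assert (He : exp (- t) * exp t = 1) by (rewrite <- exp_plus, Rplus_opp_l; apply exp_0).
  assert (0 < exp (- t)) by apply exp_pos.
  apply Rmult_le_reg_r with t; [lra|].
  replace (exp ((s + 1) * ln (s + 1)) / t * t) with (exp ((s + 1) * ln (s + 1))) by (field; lra).
  replace (exp ((s + 1) * ln (s + 1))) with ((exp ((s + 1) * ln (s + 1)) * exp t) * exp (- t)).
  - nra.
  - rewrite Rmult_assoc, (Rmult_comm (exp t)), He. ring.
Qed.

(* The integrand is dominated by a multiple of the derivative of the bounded
   function [(t / (1 + t)) ^ s]. *)
Lemma ex_gamma_integral (s : R) :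
  0 < s -> exists l, integral0oo (fun t => Rpower t (s - 1) * exp (- t)) l.
Proof.
  intros Hs.
  set (F := fun t => Rpower (t / (1 + t)) s).
  set (f := fun t => s * Rpower (t / (1 + t)) (s - 1) * / (1 + t) ^ 2).
  (* From [(1 + t) ^ (s + 1) <= (s + 1) ^ (s + 1) * exp (1 + t)]; the division by [s] cancels the
     factor [s] of the derivative [f]. *)
  set (C := exp ((s + 1) * ln (s + 1)) * exp 1 / s).
  assert (Hp : forall t, 0 < t -> 0 < t / (1 + t)) by (intros; apply Rdiv_lt_0_compat; lra).
  assert (HF : forall t, 0 < t -> is_derive F t (f t)).
  { intros t Ht. unfold F, f.
    evar_last.
    - apply (is_derive_comp (K := R_AbsRing) (V := R_NormedModule) (fun x => Rpower x s) (fun t => t / (1 + t))).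
      + apply is_derive_Rpower, Hp, Ht.
      + auto_derive; [lra|reflexivity].
    - unfold scal; simpl; unfold mult; simpl. field. lra. }
  assert (Hf : cont_pos f).
  { intros t Ht. unfold f. specialize (Hp t Ht).
    unfold Rdiv in Hp.
    apply (ex_derive_continuous (V := R_NormedModule)). unfold Rpower, Rdiv.
    auto_derive. repeat split; try lra. apply Rgt_not_eq. nra. }
  assert (HI : integral0oo f (1 - 0)).
  { apply integral0oo_antiderivative with F; auto.
    - apply filterlim_at_right_0 with s; [lra|]. intros t Ht. unfold F.
      rewrite Rabs_pos_eq by apply Rlt_le, Rpower_pos.
      apply Rle_Rpower_l; [lra|]. split; [apply Hp, Ht|].
      apply Rmult_le_reg_r with (1 + t); [lra|]. unfold Rdiv. rewrite Rmult_assoc, Rinv_l by lra. nra.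
    - replace 1 with (Rpower 1 s) by (unfold Rpower; rewrite ln_1, Rmult_0_r; apply exp_0).
      apply filterlim_comp with (G := locally 1) (g := fun x => Rpower x s) (f := fun t => t / (1 + t)).
      + apply filterlim_p_infty_inv with 1. intros t Ht.
        replace (t / (1 + t) - 1) with (- / (1 + t)) by (field; lra).
        rewrite Rabs_Ropp, Rabs_pos_eq by (apply Rlt_le, Rinv_0_lt_compat; lra).
        unfold Rdiv. rewrite Rmult_1_l. apply Rinv_le_contravar; lra.
      + apply cont_pos_Rpower. lra. }
  apply (integral0oo_scal C) in HI.
  apply integral0oo_dominated with (2 := cont_pos_mult (fun _ => C) f (cont_pos_const C) Hf) (4 := HI).
  - apply cont_pos_mult; [apply cont_pos_Rpower | apply cont_pos_expN].
  - intros t Ht.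
    rewrite Rabs_pos_eq by (apply Rmult_le_pos; apply Rlt_le; apply exp_pos).
    assert (H := Rpower_le_exp (s + 1) (1 + t) ltac:(lra) ltac:(lra)).
    assert (E : Rpower t (s - 1) = Rpower (t / (1 + t)) (s - 1) * (Rpower (1 + t) (s + 1) * / (1 + t) ^ 2)).
    { replace (/ (1 + t) ^ 2) with (Rpower (1 + t) (- (2))).
      - rewrite <- Rpower_plus. replace (s + 1 + - (2)) with (s - 1) by ring.
        rewrite Rpower_mult_distr; [|apply Hp, Ht|lra].
        f_equal. field. lra.
      - rewrite Rpower_Ropp. f_equal. replace 2 with (INR 2) by (simpl; ring).
        apply Rpower_pow. lra. }
    rewrite E. unfold C, f.
    replace (exp ((s + 1) * ln (s + 1)) * exp 1 / s *
      (s * Rpower (t / (1 + t)) (s - 1) * / (1 + t) ^ 2)) with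
      (Rpower (t / (1 + t)) (s - 1) * / (1 + t) ^ 2 * (exp ((s + 1) * ln (s + 1)) * exp (1 + t)) * exp (- t)).
    + assert (0 < Rpower (t / (1 + t)) (s - 1)) by apply Rpower_pos.
      assert (0 < / (1 + t) ^ 2) by (apply Rinv_0_lt_compat, pow_lt; lra).
      assert (0 < exp (- t)) by apply exp_pos.
      apply Rmult_le_compat_r; [lra|].
      rewrite (Rmult_comm (Rpower (1 + t) (s + 1))), <- Rmult_assoc.
      apply Rmult_le_compat_l; [nra|exact H].
    + assert (E2 : exp (1 + t) * exp (- t) = exp 1) by (rewrite <- exp_plus; f_equal; ring).
      rewrite <- E2. field. split; [|lra]. lra.
Qed.

Definition expo_bounded (h : R -> R) : Prop :=
  cont_pos h /\ exists C, forall t, 0 < t -> Rabs (h t) <= C * exp (- t).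

Definition expN (t : R) : R := exp (- t).

Lemma expo_bounded_expN : expo_bounded expN.
Proof.
  split; [apply cont_pos_expN|]. exists 1. intros t _. unfold expN.
  rewrite Rabs_pos_eq; [lra|apply Rlt_le, exp_pos].
Qed.

(** Two exponents are allowed because a weight containing powers of [ln t] exceeds a single power of
    [t] at both ends: the smaller exponent serves near 0, the larger one near infinity. *)
Lemma ex_integral_expo_bounded (w h : R -> R) (s1 s2 C1 : R) :
  expo_bounded h -> cont_pos w -> 0 < s1 -> 0 < s2 ->
  (forall t, 0 < t -> Rabs (w t) <= C1 * (Rpower t (s1 - 1) + Rpower t (s2 - 1))) ->
  exists l, integral0oo (fun t => w t * h t) l.
Proof.
  intros [Hh [C HC]] Hw H1 H2 Hb.
  destruct (ex_gamma_integral s1 H1) as [l1 L1].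
  destruct (ex_gamma_integral s2 H2) as [l2 L2].
  assert (L := integral0oo_scal (C1 * C) _ _ (integral0oo_plus _ _ _ _ L1 L2)).
  apply integral0oo_dominated with (4 := L).
  - apply cont_pos_mult; assumption.
  - apply cont_pos_mult; [apply cont_pos_const|].
    apply cont_pos_plus; (apply cont_pos_mult; [apply cont_pos_Rpower|apply cont_pos_expN]).
  - intros t Ht. rewrite Rabs_mult.
    replace (C1 * C * (Rpower t (s1 - 1) * exp (- t) + Rpower t (s2 - 1) * exp (- t)))
      with (C1 * (Rpower t (s1 - 1) + Rpower t (s2 - 1)) * (C * exp (- t))) by ring.
    apply Rmult_le_compat; try apply Rabs_pos; auto.
Qed.

Lemma is_mellin (h : R -> R) (s : R) :
  expo_bounded h -> 0 < s ->
  integral0oo (fun t => Rpower t (s - 1) * h t) (mellin h s).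
Proof.
  intros Hh Hs.
  apply integral0oo_RInt_gen.
  apply (ex_integral_expo_bounded _ h s s 1); auto.
  - apply cont_pos_Rpower.
  - intros t Ht. assert (H := Rpower_pos t (s - 1)). rewrite Rabs_pos_eq; lra.
Qed.

Definition gam (s : R) : R := mellin expN s.

Lemma is_gam (s : R) : 0 < s -> integral0oo (fun t => Rpower t (s - 1) * exp (- t)) (gam s).
Proof. intros Hs. apply (is_mellin expN s expo_bounded_expN Hs). Qed.

(** Integration by parts: the difference of the two integrands is the derivative of
    [t ^ s * exp (- t)], which tends to 0 at both ends. *)
Lemma gam_succ (s : R) : 0 < s -> gam (s + 1) = s * gam s.
Proof.
  intros Hs.
  assert (H1 := is_gam (s + 1) ltac:(lra)).
  assert (H2 := integral0oo_scal s _ _ (is_gam s Hs)).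
  assert (H3 := integral0oo_minus _ _ _ _ H2 H1).
  assert (H4 : integral0oo (fun t => s * (Rpower t (s - 1) * exp (- t)) - Rpower t (s + 1 - 1) * exp (- t)) (0 - 0)).
  { apply integral0oo_antiderivative with (fun t => Rpower t s * exp (- t)).
    - intros t Ht. replace (s + 1 - 1) with s by ring.
      evar_last.
      + apply (is_derive_mult (K := R_AbsRing) (fun t => Rpower t s) (fun t => exp (- t))).
        * apply is_derive_Rpower, Ht.
        * auto_derive; [exact I|reflexivity].
        * intros; apply Rmult_comm.
      + unfold plus, mult; simpl. ring.
    - intros t Ht. apply (continuous_minus (V := R_NormedModule)).
      + apply (cont_pos_mult (fun _ => s) (fun t => Rpower t (s - 1) * exp (- t))); auto.
        * apply cont_pos_const.
        * apply cont_pos_mult; [apply cont_pos_Rpower|apply cont_pos_expN].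
      + apply (cont_pos_mult (fun t => Rpower t (s + 1 - 1)) (fun t => exp (- t))); auto.
        * apply cont_pos_Rpower.
        * apply cont_pos_expN.
    - apply filterlim_at_right_0 with s; [lra|]. intros t Ht.
      rewrite Rabs_pos_eq by (apply Rmult_le_pos; apply Rlt_le; apply exp_pos).
      rewrite <- (Rmult_1_r (Rpower t s)) at 2.
      apply Rmult_le_compat_l; [apply Rlt_le, Rpower_pos|].
      rewrite <- exp_0. left. apply exp_increasing. lra.
    - apply filterlim_p_infty_inv with (exp ((s + 1) * ln (s + 1))). intros t Ht.
      rewrite Rminus_0_r.
      rewrite Rabs_pos_eq by (apply Rmult_le_pos; apply Rlt_le; apply exp_pos).
      apply Rpower_exp_le_inv; auto. }
  assert (H5 := integral0oo_unique _ _ _ H3 H4). lra.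
Qed.

Lemma gam_1 : gam 1 = 1.
Proof.
  apply integral0oo_unique with (fun t => exp (- t)).
  - apply integral0oo_ext with (2 := is_gam 1 Rlt_0_1). intros t Ht.
    rewrite Rminus_diag, Rpower_O by exact Ht. ring.
  - replace 1 with (0 - (-1)) by ring.
    apply integral0oo_antiderivative with (fun t => - exp (- t)).
    + intros t Ht. auto_derive; [exact I|]. ring.
    + apply cont_pos_expN.
    + refine (filterlim_filter_le_1 (F := locally 0) _ _ _).
      { intros P [e HP]. exists e. intros y Hy _. apply HP, Hy. }
      assert (E : continuous (fun t => - exp (- t)) 0).
      { apply (ex_derive_continuous (V := R_NormedModule)). auto_derive. exact I. }
      unfold continuous in E. rewrite Ropp_0, exp_0 in E. exact E.
    + apply filterlim_p_infty_inv with 1. intros t Ht.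
      rewrite Rminus_0_r, Rabs_Ropp, Rabs_pos_eq, exp_Ropp by apply Rlt_le, exp_pos.
      unfold Rdiv. rewrite Rmult_1_l. apply Rinv_le_contravar; [lra|].
      assert (H := exp_ineq1_le t). lra.
Qed.

Lemma gam_scale (s k : R) :
  0 < s -> 0 < k ->
  integral0oo (fun t => Rpower t (s - 1) * exp (- (k * t))) (Rpower k (- s) * gam s).
Proof.
  intros Hs Hk.
  assert (H := integral0oo_comp_scal _ k _ Hk
    (cont_pos_mult _ _ (cont_pos_Rpower (s - 1)) cont_pos_expN) (is_gam s Hs)).
  apply (integral0oo_scal (Rpower k (1 - s))) in H.
  replace (Rpower k (- s) * gam s) with (Rpower k (1 - s) * (gam s / k)).
  - apply integral0oo_ext with (2 := H). intros t Ht. cbv beta.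
    rewrite <- Rpower_mult_distr by assumption.
    rewrite <- !Rmult_assoc, <- Rpower_plus.
    replace (1 - s + (s - 1)) with 0 by ring. rewrite Rpower_O by exact Hk. ring.
  - unfold Rminus. rewrite Rpower_plus, Rpower_1 by exact Hk. field. lra.
Qed.

(** For [s <= 1], [ln t <= t] gives [t ^ (s - 1) >= exp (- (1 - s) * t)], so the integrand is at
    least [exp (- (2 - s) * t)], whose integral is the positive number [1 / (2 - s)]. *)
Lemma gam_pos_le_1 (s : R) : 0 < s <= 1 -> 0 < gam s.
Proof.
  intros Hs.
  assert (H := gam_scale 1 (2 - s) ltac:(lra) ltac:(lra)).
  rewrite gam_1, Rmult_1_r in H.
  apply Rlt_le_trans with (Rpower (2 - s) (- (1))); [apply Rpower_pos|].
  eapply Rle_trans; [apply Rle_abs|].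
  refine (integral0oo_bound _ _ _ _ _ H (is_gam s (proj1 Hs))).
  intros t Ht. cbv beta.
  rewrite Rminus_diag, Rpower_O, Rmult_1_l by exact Ht.
  rewrite Rabs_pos_eq by apply Rlt_le, exp_pos.
  unfold Rpower. rewrite <- exp_plus.
  assert (ln t <= t).
  { rewrite <- (ln_exp t) at 2. apply ln_le; [lra|]. assert (H1 := exp_ineq1_le t). lra. }
  destruct (Req_dec ((s - 1) * ln t + - t) (- ((2 - s) * t))) as [E|E].
  - rewrite E. lra.
  - left. apply exp_increasing. nra.
Qed.

Lemma gam_pos (s : R) : 0 < s -> 0 < gam s.
Proof.
  intros Hs.
  assert (H : forall k s, 0 < s <= INR k + 1 -> 0 < gam s).
  { clear. induction k as [|k IH]; intros s Hs.
    - apply gam_pos_le_1. simpl in Hs. lra.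
    - destruct (Rle_dec s 1) as [H1|H1]; [apply gam_pos_le_1; lra|].
      replace s with (s - 1 + 1) by ring. rewrite gam_succ by lra.
      apply Rmult_lt_0_compat; [lra|]. apply IH. rewrite S_INR in Hs. lra. }
  destruct (nfloor_ex s ltac:(lra)) as [k Hk].
  apply (H k). lra.
Qed.

(** * Mellin transforms are analytic *)

Lemma is_lim_seq_bound (u v : nat -> R) (l : R) :
  (forall n, Rabs (u n - l) <= v n) -> is_lim_seq v 0 -> is_lim_seq u l.
Proof.
  intros H Hv.
  apply is_lim_seq_ext with (fun n => (u n - l) + l); [intros; ring|].
  replace (Finite l) with (Rbar_plus 0 l) by (simpl; f_equal; ring).
  apply is_lim_seq_plus'; [|apply is_lim_seq_const].
  apply is_lim_seq_abs_0.
  apply is_lim_seq_le_le with (fun _ => 0) v; auto; [|apply is_lim_seq_const].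
  intros n. split; [apply Rabs_pos | apply H].
Qed.

Lemma is_series_exp (y : R) : is_series (fun j => y ^ j / INR (fact j)) (exp y).
Proof.
  assert (H := proj1 (is_pseries_R _ _ _) (is_exp_Reals y)).
  apply is_series_ext with (2 := H). intros j. unfold Rdiv. apply Rmult_comm.
Qed.

Lemma INR_fact_pos (j : nat) : 0 < INR (fact j).
Proof. apply lt_0_INR, lt_O_fact. Qed.

(** Compare with the exponential series at [2 * Rabs y]: every term of index above [J] gains at
    least the factor [(1 / 2) ^ S J]. The bound separates the decay in [J] from the growth in [y],
    which is what integration over [y = d * ln t] requires. *)
Lemma exp_taylor_remainder (y : R) (J : nat) :
  Rabs (exp y - sum_n (fun j => y ^ j / INR (fact j)) J) <=
  (1 / 2) ^ S J * exp (2 * Rabs y).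
Proof.
  set (a := fun z j => z ^ j / INR (fact j)).
  assert (T : forall z, is_series (fun k => a z (S J + k)%nat) (exp z - sum_n (a z) J)).
  { intros z. apply (is_series_incr_n (V := R_NormedModule) (a z) (S J)); [lia|].
    match goal with |- is_series _ ?l => replace l with (exp z) end.
    - apply is_series_exp.
    - change (exp z = exp z - sum_n (a z) J + sum_n (a z) J). ring. }
  set (y2 := 2 * Rabs y). fold (a y).
  assert (T2 := is_series_scal_l (V := R_NormedModule) ((1 / 2) ^ S J) _ _ (T y2)).
  assert (Hy : 0 <= y2) by (unfold y2; assert (H := Rabs_pos y); lra).
  assert (Hle : forall k, norm (a y (S J + k)%nat) <= scal ((1 / 2) ^ S J) (a y2 (S J + k)%nat)).
  { intros k. change (Rabs (a y (S J + k)%nat) <= (1 / 2) ^ S J * a y2 (S J + k)%nat). unfold a.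
    assert (HF := INR_fact_pos (S J + k)).
    unfold Rdiv. rewrite Rabs_mult, (Rabs_pos_eq (/ _)) by (apply Rlt_le, Rinv_0_lt_compat, HF).
    rewrite <- (Rmult_assoc _ _ (/ INR (fact (S J + k)))).
    apply Rmult_le_compat_r; [apply Rlt_le, Rinv_0_lt_compat, HF|].
    rewrite <- RPow_abs.
    replace (Rabs y) with (1 / 2 * y2) by (unfold y2; field).
    rewrite Rpow_mult_distr. apply Rmult_le_compat_r; [apply pow_le, Hy|].
    rewrite pow_add. unfold Rdiv.
    rewrite <- (Rmult_1_r ((1 * / 2) ^ S J)) at 2.
    apply Rmult_le_compat_l; [apply pow_le; lra|].
    apply Rle_trans with (1 ^ k); [apply pow_incr; lra | rewrite pow1; lra]. }
  assert (E : ex_series (fun k => Rabs (a y (S J + k)%nat))).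
  { apply (ex_series_le (V := R_CompleteNormedModule)) with (2 := ex_intro _ _ T2).
    intros k. unfold norm at 1; simpl. unfold abs; simpl. rewrite Rabs_Rabsolu. apply Hle. }
  rewrite <- (is_series_unique _ _ (T y)).
  eapply Rle_trans; [apply Series_Rabs, E|].
  eapply Rle_trans.
  { apply Series_le with (2 := ex_intro _ _ T2). intros k. split; [apply Rabs_pos|apply Hle]. }
  rewrite (is_series_unique _ _ T2).
  unfold scal; simpl; unfold mult; simpl.
  change (1 / 2 * (1 / 2) ^ J) with ((1 / 2) ^ S J).
  apply Rmult_le_compat_l; [apply pow_le; lra|].
  assert (0 <= sum_n (a y2) J).
  { rewrite sum_n_Reals. apply cond_pos_sum. intros j. unfold a.
    apply Rmult_le_pos; [apply pow_le, Hy|apply Rlt_le, Rinv_0_lt_compat, INR_fact_pos]. }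
  lra.
Qed.

Lemma pow_fact_le_exp (w : R) (j : nat) : 0 <= w -> w ^ j / INR (fact j) <= exp w.
Proof.
  intros Hw.
  assert (Hp : forall k, 0 <= w ^ k / INR (fact k)).
  { intros k. apply Rmult_le_pos; [apply pow_le, Hw|apply Rlt_le, Rinv_0_lt_compat, INR_fact_pos]. }
  apply Rle_trans with (sum_n (fun k => w ^ k / INR (fact k)) j).
  - destruct j; [rewrite sum_O; lra|]. rewrite sum_Sn. unfold plus; simpl.
    rewrite sum_n_Reals. assert (H := cond_pos_sum _ j Hp).
    assert (H2 := Hp (S j)). simpl in *. lra.
  - rewrite sum_n_Reals. apply sum_incr; [|exact Hp].
    apply is_lim_seq_Reals. apply is_lim_seq_ext with (2 := is_series_exp w).
    intros n. apply sum_n_Reals.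
Qed.

Lemma exp_abs_ln_le (r t : R) : 0 < t ->
  exp (r * Rabs (ln t)) <= Rpower t r + Rpower t (- r).
Proof.
  intros Ht. unfold Rpower.
  assert (H1 := exp_pos (r * ln t)). assert (H2 := exp_pos (- r * ln t)).
  unfold Rabs. destruct Rcase_abs.
  - replace (r * - ln t) with (- r * ln t) by ring. lra.
  - lra.
Qed.

Definition analytic_real (f : R -> R) (x : R) : Prop :=
  exists a : nat -> R, locally x (fun y => is_pseries a (y - x) (f y)).

(** The [j]th Taylor coefficient at [s = x] of [Rpower t (s - 1)] as a function of [s]. *)
Definition log_moment (x : R) (j : nat) (t : R) : R :=
  Rpower t (x - 1) * (ln t ^ j / INR (fact j)).

Lemma cont_pos_log_moment (x : R) (j : nat) : cont_pos (log_moment x j).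
Proof.
  apply cont_pos_mult; [apply cont_pos_Rpower|].
  intros t Ht. apply (ex_derive_continuous (V := R_NormedModule)).
  auto_derive. exact Ht.
Qed.

(** The partial sum misses the transform by the integral of an exponential remainder. As
    [2 * Rabs d <= r], its growth [exp (2 * Rabs (d * ln t))] is at most [t ^ r + t ^ (- r)], and
    [r < x] keeps both resulting Gamma integrals convergent. *)
Lemma mellin_expand (h : R -> R) (x d : R) (a : nat -> R) (r C : R) :
  expo_bounded h -> 0 < r < x -> Rabs d <= r / 2 ->
  (forall t, 0 < t -> Rabs (h t) <= C * exp (- t)) ->
  (forall j, integral0oo (fun t => log_moment x j t * h t) (a j)) ->
  is_pseries a d (mellin h (x + d)).
Proof.
  intros Hh Hr Hd HC Ha.
  assert (Hd' : - (r / 2) <= d <= r / 2) by (apply Rabs_le_between, Hd).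
  apply is_pseries_R.
  change (is_lim_seq (sum_n (fun j => a j * d ^ j)) (mellin h (x + d))).
  apply is_lim_seq_bound with
    (fun J => (1 / 2) ^ S J * (C * (gam (x + r) + gam (x - r)))).
  - intros J.
    assert (I1 := integral0oo_sum (fun j t => d ^ j * (log_moment x j t * h t)) (fun j => d ^ j * a j) J
      (fun j _ => integral0oo_scal (d ^ j) _ _ (Ha j))).
    assert (I2 := integral0oo_minus _ _ _ _ I1 (is_mellin h (x + d) Hh ltac:(lra))).
    replace (sum_n (fun j => d ^ j * a j) J) with (sum_n (fun j => a j * d ^ j) J) in I2
      by (apply sum_n_ext; intros; apply Rmult_comm).
    assert (I3 := integral0oo_scal ((1 / 2) ^ S J) _ _ (integral0oo_scal C _ _
      (integral0oo_plus _ _ _ _ (is_gam (x + r) ltac:(lra)) (is_gam (x - r) ltac:(lra))))).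
    refine (integral0oo_bound _ _ _ _ _ I2 I3).
    intros t Ht. cbv beta.
    set (y := d * ln t).
    assert (E1 : sum_n (fun i => d ^ i * (log_moment x i t * h t)) J =
      Rpower t (x - 1) * sum_n (fun j => y ^ j / INR (fact j)) J * h t).
    { rewrite (Rmult_comm _ (h t)), <- Rmult_assoc.
      rewrite <- (sum_n_mult_l (K := R_Ring)).
      apply sum_n_ext. intros j. unfold mult; simpl. unfold log_moment, y.
      rewrite Rpow_mult_distr. field. apply Rgt_not_eq, INR_fact_pos. }
    assert (E2 : Rpower t (x + d - 1) = Rpower t (x - 1) * exp y).
    { unfold y. change (exp (d * ln t)) with (Rpower t d).
      rewrite <- Rpower_plus. f_equal. ring. }
    rewrite E1, E2.
    replace (Rpower t (x - 1) * sum_n (fun j => y ^ j / INR (fact j)) J * h t -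
       Rpower t (x - 1) * exp y * h t)
      with (Rpower t (x - 1) * (- (exp y - sum_n (fun j => y ^ j / INR (fact j)) J)) * h t) by ring.
    rewrite !Rabs_mult, Rabs_Ropp, (Rabs_pos_eq (Rpower _ _)) by apply Rlt_le, Rpower_pos.
    replace (x + r - 1) with (x - 1 + r) by ring.
    replace (x - r - 1) with (x - 1 + - r) by ring.
    rewrite !Rpower_plus.
    replace ((1 / 2) ^ S J * (C *
      (Rpower t (x - 1) * Rpower t r * exp (- t) + Rpower t (x - 1) * Rpower t (- r) * exp (- t))))
      with (Rpower t (x - 1) * ((1 / 2) ^ S J * (Rpower t r + Rpower t (- r))) * (C * exp (- t))) by ring.
    assert (HT := exp_taylor_remainder y J).
    assert (0 < Rpower t (x - 1)) by apply Rpower_pos.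
    assert (0 < (1 / 2) ^ S J) by (apply pow_lt; lra).
    assert (HE : exp (2 * Rabs y) <= Rpower t r + Rpower t (- r)).
    { eapply Rle_trans; [|apply exp_abs_ln_le, Ht].
      unfold y. rewrite Rabs_mult. assert (H1 := Rabs_pos (ln t)).
      destruct (Req_dec (2 * (Rabs d * Rabs (ln t))) (r * Rabs (ln t))) as [E|E].
      - rewrite E. lra.
      - left. apply exp_increasing. nra. }
    apply Rmult_le_compat; auto.
    + apply Rmult_le_pos; [lra|apply Rabs_pos].
    + apply Rabs_pos.
    + apply Rmult_le_compat_l; [lra|].
      eapply Rle_trans; [exact HT|]. apply Rmult_le_compat_l; lra.
  - apply is_lim_seq_ext with (fun J => (1 / 2) ^ J * ((1 / 2) * (C * (gam (x + r) + gam (x - r))))).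
    { intros J. simpl. ring. }
    replace (Finite 0) with (Rbar_mult 0 ((1 / 2) * (C * (gam (x + r) + gam (x - r)))))
      by (simpl; f_equal; ring).
    apply is_lim_seq_mult'; [|apply is_lim_seq_const].
    apply is_lim_seq_geom. rewrite Rabs_pos_eq; lra.
Qed.

Lemma locally_Rabs (x e : R) (P : R -> Prop) :
  0 < e -> (forall y, Rabs (y - x) < e -> P y) -> locally x P.
Proof. intros He H. exists (mkposreal e He). intros y Hy. apply H, Hy. Qed.

Lemma locally_Rabs_elim (x : R) (P : R -> Prop) :
  locally x P -> exists e, 0 < e /\ forall y, Rabs (y - x) < e -> P y.
Proof. intros [e H]. exists e. split; [apply cond_pos|]. intros y Hy. apply H, Hy. Qed.

(* Expand [t ^ (y - x)] in powers of [(y - x) * ln t] and integrate term by term. *)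
Lemma analytic_mellin (h : R -> R) (x : R) :
  expo_bounded h -> 0 < x -> analytic_real (mellin h) x.
Proof.
  intros Hh Hx.
  destruct (proj2 Hh) as [C HC].
  set (r := x / 2).
  exists (fun j => RInt_gen (fun t => log_moment x j t * h t) (at_right 0) (Rbar_locally p_infty)).
  apply locally_Rabs with (r / 2); [unfold r; lra|].
  intros y Hy.
  replace (mellin h y) with (mellin h (x + (y - x))) by (f_equal; ring).
  apply mellin_expand with r C; auto; [unfold r; lra|lra|].
  intros j. apply integral0oo_RInt_gen.
  (* The constant comes from [(r * Rabs (ln t)) ^ j / j! <= exp (r * Rabs (ln t))]. *)
  apply (ex_integral_expo_bounded _ h (x + r) (x - r) (/ r ^ j)); auto;
    try apply cont_pos_log_moment; try (unfold r; lra).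
  intros t Ht. unfold log_moment.
  assert (0 < r ^ j) by (apply pow_lt; unfold r; lra).
  replace (x + r - 1) with (x - 1 + r) by ring.
  replace (x - r - 1) with (x - 1 + - r) by ring.
  rewrite !Rpower_plus, Rabs_mult, (Rabs_pos_eq (Rpower _ _)) by apply Rlt_le, Rpower_pos.
  assert (HF := INR_fact_pos j).
  unfold Rdiv. rewrite Rabs_mult, (Rabs_pos_eq (/ _)) by (apply Rlt_le, Rinv_0_lt_compat, HF).
  rewrite <- RPow_abs.
  assert (H1 := pow_fact_le_exp (r * Rabs (ln t)) j ltac:(apply Rmult_le_pos; [unfold r; lra|apply Rabs_pos])).
  assert (H2 := exp_abs_ln_le r t Ht).
  rewrite Rpow_mult_distr in H1.
  apply Rle_trans with (Rpower t (x - 1) * (/ r ^ j * (Rpower t r + Rpower t (- r)))); [|right; ring].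
  apply Rmult_le_compat_l; [apply Rlt_le, Rpower_pos|].
  apply Rmult_le_reg_l with (r ^ j); [lra|].
  rewrite <- (Rmult_assoc (r ^ j) (/ _)), Rinv_r, Rmult_1_l by lra.
  unfold Rdiv in H1. rewrite Rmult_assoc in H1. lra.
Qed.

(** * Real-analytic functions and the identity theorem *)

Definition punctured_zero (f : R -> R) (x : R) : Prop :=
  exists e, 0 < e /\ forall y, 0 < Rabs (y - x) < e -> f y = 0.

Definition punctured_pseries (a : nat -> R) (f : R -> R) (x : R) : Prop :=
  exists e, 0 < e /\ forall y, 0 < Rabs (y - x) < e -> is_pseries a (y - x) (f y).

(** With no condition on [a 0], the number [k] only bounds the order of a pole, so analytic points
    are covered too. *)
Definition laurent_real (f : R -> R) (x : R) : Prop :=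
  exists k a, punctured_pseries a (fun y => (y - x) ^ k * f y) x.

Lemma pseries_bounded (a : nat -> R) (d l : R) :
  is_pseries a d l -> exists B, forall k, Rabs (a k * d ^ k) <= B.
Proof.
  intros H. apply is_pseries_R in H.
  assert (H0 := ex_series_lim_0 _ (ex_intro _ l H)).
  destruct (maj_by_pos (fun k => a k * d ^ k)) as [B [_ HB]]; [|exists B; exact HB].
  exists 0. apply is_lim_seq_Reals, H0.
Qed.

Lemma radius_ge (a : nat -> R) (d l : R) :
  is_pseries a d l -> Rbar_le (Rabs d) (CV_radius a).
Proof.
  intros H. destruct (Rbar_le_lt_dec (Rabs d) (CV_radius a)) as [h|h]; [exact h|].
  exfalso. apply (CV_disk_outside a d h).
  apply is_pseries_R in H. exact (ex_series_lim_0 _ (ex_intro _ l H)).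
Qed.

Lemma punctured_radius (a : nat -> R) (f : R -> R) (x e : R) :
  0 < e -> (forall y, 0 < Rabs (y - x) < e -> is_pseries a (y - x) (f y)) ->
  Rbar_le (e / 2) (CV_radius a).
Proof.
  intros He H.
  assert (E : x + e / 2 - x = e / 2) by ring.
  assert (H2 := H (x + e / 2)). rewrite E, Rabs_pos_eq in H2 by lra.
  assert (H3 := radius_ge _ _ _ (H2 ltac:(lra))).
  rewrite Rabs_pos_eq in H3 by lra. exact H3.
Qed.

Lemma analytic_elim (f : R -> R) (x : R) :
  analytic_real f x -> exists a e, 0 < e /\ Rbar_le e (CV_radius a) /\
    forall y, Rabs (y - x) < e -> is_pseries a (y - x) (f y).
Proof.
  intros [a Ha]. destruct (locally_Rabs_elim _ _ Ha) as (e & He & H).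
  exists a, (e / 2). repeat split; [lra| |intros; apply H; lra].
  apply punctured_radius with f x; auto. intros y Hy. apply H; lra.
Qed.

Lemma punctured_elim (a : nat -> R) (f : R -> R) (x : R) :
  punctured_pseries a f x -> exists e, 0 < e /\ Rbar_le e (CV_radius a) /\
    forall y, 0 < Rabs (y - x) < e -> is_pseries a (y - x) (f y).
Proof.
  intros (e & He & H).
  exists (e / 2). repeat split; [lra| |intros; apply H; lra].
  apply punctured_radius with f x; auto.
Qed.

Lemma analytic_intro (a : nat -> R) (f : R -> R) (x e : R) :
  0 < e -> (forall y, Rabs (y - x) < e -> is_pseries a (y - x) (f y)) ->
  analytic_real f x.
Proof. intros He H. exists a. apply locally_Rabs with e; auto. Qed.

Lemma lt_radius (a : nat -> R) (d e : R) :
  Rabs d < e -> Rbar_le e (CV_radius a) -> Rbar_lt (Rabs d) (CV_radius a).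
Proof. intros H1 H2. apply Rbar_lt_le_trans with e; auto. Qed.

Lemma is_pseries_scal_R (c : R) (a : nat -> R) (x l : R) :
  is_pseries a x l -> is_pseries (PS_scal c a) x (c * l).
Proof. apply (is_pseries_scal c a x l). apply Rmult_comm. Qed.

Lemma analytic_derive (f : R -> R) (x : R) (a : nat -> R) :
  locally x (fun y => is_pseries a (y - x) (f y)) -> is_derive f x (a 1%nat).
Proof.
  intros Ha. destruct (locally_Rabs_elim _ _ Ha) as (e & He & H).
  assert (HR : Rbar_lt (Rabs 0) (CV_radius a)).
  { apply lt_radius with (e / 2); [rewrite Rabs_R0; lra|].
    apply punctured_radius with f x; auto. intros; apply H; lra. }
  apply is_derive_ext_loc with (fun y => PSeries a (y - x)).
  { apply locally_Rabs with e; auto. intros y Hy. apply is_pseries_unique, H, Hy. }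
  evar_last.
  - apply (is_derive_comp (K := R_AbsRing) (V := R_NormedModule) (PSeries a) (fun y => y - x)).
    + rewrite Rminus_diag. apply is_derive_PSeries, HR.
    + auto_derive; [exact I|reflexivity].
  - rewrite PSeries_0. unfold PS_derive, scal; simpl; unfold mult; simpl. ring.
Qed.


Lemma analytic_plus (f g : R -> R) (x : R) :
  analytic_real f x -> analytic_real g x -> analytic_real (fun y => f y + g y) x.
Proof.
  intros Hf Hg.
  destruct (analytic_elim f x Hf) as (a & e & He & _ & Ha).
  destruct (analytic_elim g x Hg) as (b & e' & He' & _ & Hb).
  apply analytic_intro with (PS_plus a b) (Rmin e e'); [now apply Rmin_glb_lt|].
  intros y Hy. apply (is_pseries_plus a b).
  - apply Ha. apply Rlt_le_trans with (1 := Hy), Rmin_l.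
  - apply Hb. apply Rlt_le_trans with (1 := Hy), Rmin_r.
Qed.

Lemma analytic_mult (f g : R -> R) (x : R) :
  analytic_real f x -> analytic_real g x -> analytic_real (fun y => f y * g y) x.
Proof.
  intros Hf Hg.
  destruct (analytic_elim f x Hf) as (a & e & He & Ra & Ha).
  destruct (analytic_elim g x Hg) as (b & e' & He' & Rb & Hb).
  apply analytic_intro with (PS_mult a b) (Rmin e e'); [now apply Rmin_glb_lt|].
  intros y Hy.
  assert (H1 := Rlt_le_trans _ _ _ Hy (Rmin_l e e')).
  assert (H2 := Rlt_le_trans _ _ _ Hy (Rmin_r e e')).
  apply is_pseries_mult; eauto using lt_radius.
Qed.

Lemma analytic_const (c x : R) : analytic_real (fun _ => c) x.
Proof.
  apply analytic_intro with (fun k => match k with O => c | _ => 0 end) 1; [lra|].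
  intros y _. apply is_pseries_R.
  match goal with |- is_series ?f _ => change (is_lim_seq (sum_n f) c) end.
  apply is_lim_seq_ext with (fun _ => c); [|apply is_lim_seq_const].
  induction n as [|n IH]; [rewrite sum_O; simpl; ring|].
  rewrite sum_Sn, <- IH. unfold plus; simpl. ring.
Qed.

Lemma analytic_affine (c x : R) : analytic_real (fun y => y + c) x.
Proof.
  apply analytic_intro with (fun k => match k with O => x + c | S O => 1 | _ => 0 end) 1; [lra|].
  intros y _. apply is_pseries_R.
  match goal with |- is_series ?f _ => change (is_lim_seq (sum_n f) (y + c)) end.
  apply is_lim_seq_incr_1.
  apply is_lim_seq_ext with (fun _ => y + c); [|apply is_lim_seq_const].
  induction n as [|n IH].
  - rewrite sum_Sn, sum_O. unfold plus; simpl. ring.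
  - rewrite sum_Sn, <- IH. unfold plus; simpl. ring.
Qed.

Lemma analytic_shift (f : R -> R) (c x : R) :
  analytic_real f (x + c) -> analytic_real (fun y => f (y + c)) x.
Proof.
  intros Hf. destruct (analytic_elim f _ Hf) as (a & e & He & _ & Ha).
  apply analytic_intro with a e; auto. intros y Hy.
  replace (y - x) with (y + c - (x + c)) by ring. apply Ha.
  replace (y + c - (x + c)) with (y - x) by ring. exact Hy.
Qed.

Lemma analytic_sum (f : nat -> R -> R) (N : nat) (x : R) :
  (forall i, analytic_real (f i) x) -> analytic_real (fun y => sum_n (fun i => f i y) N) x.
Proof.
  intros H. induction N as [|N [a IH]].
  - destruct (H 0%nat) as [a Ha]. exists a. apply filter_imp with (2 := Ha).
    intros y Hy. now rewrite sum_O.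
  - destruct (analytic_plus _ _ _ (ex_intro _ a IH) (H (S N))) as [b Hb].
    exists b. apply filter_imp with (2 := Hb). intros y Hy. now rewrite sum_Sn.
Qed.

(** This is the shape in which [L] is compared with its continuation once denominators are cleared.
    The exponent [k] of [u] still serves: [B] is analytic, hence so is its product with
    [(y - x) ^ k]. *)
Lemma laurent_affine (u A B : R -> R) (x : R) :
  laurent_real u x -> analytic_real A x -> analytic_real B x ->
  laurent_real (fun y => A y * u y - B y) x.
Proof.
  intros (k & a & Hu) HA HB.
  destruct (punctured_elim _ _ _ Hu) as (e & He & Ra & Ha).
  destruct (analytic_elim A x HA) as (b & e' & He' & Rb & Hb).
  assert (HP : analytic_real (fun y => (y - x) ^ k * - B y) x).
  { apply analytic_mult.
    - clear. induction k as [|k IH]; [apply (analytic_const 1)|].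
      simpl. apply (analytic_mult (fun y => y - x)); [apply analytic_affine|exact IH].
    - destruct (analytic_mult _ _ _ (analytic_const (-1) x) HB) as [c Hc].
      exists c. apply filter_imp with (2 := Hc). intros y Hy.
      replace (- B y) with (-1 * B y) by ring. exact Hy. }
  destruct (analytic_elim _ x HP) as (c & e'' & He'' & Rc & Hc).
  exists k, (PS_plus (PS_mult b a) c), (Rmin e (Rmin e' e'')).
  split; [repeat apply Rmin_glb_lt; auto|].
  intros y [Hy0 Hy].
  assert (H1 := Rlt_le_trans _ _ _ Hy (Rmin_l _ _)).
  assert (H2 := Rlt_le_trans _ _ _ (Rlt_le_trans _ _ _ Hy (Rmin_r _ _)) (Rmin_l _ _)).
  assert (H3 := Rlt_le_trans _ _ _ (Rlt_le_trans _ _ _ Hy (Rmin_r _ _)) (Rmin_r _ _)).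
  replace ((y - x) ^ k * (A y * u y - B y))
    with (plus (A y * ((y - x) ^ k * u y)) ((y - x) ^ k * - B y))
    by (unfold plus; simpl; ring).
  apply (is_pseries_plus (PS_mult b a) c); [|auto].
  apply is_pseries_mult; eauto using lt_radius.
Qed.

Lemma punctured_nonzero_0 (a : nat -> R) (f : R -> R) (x : R) :
  punctured_pseries a f x -> a 0%nat <> 0 ->
  exists e, 0 < e /\ forall y, 0 < Rabs (y - x) < e -> f y <> 0.
Proof.
  intros Hf E.
  destruct (punctured_elim _ _ _ Hf) as (e & He & Ra & Ha).
  assert (HR : Rbar_lt (Rabs 0) (CV_radius a)).
  { apply lt_radius with e; [rewrite Rabs_R0; lra|exact Ra]. }
  assert (HC := PSeries_continuity a 0 HR).
  destruct (HC (Rabs (a 0%nat)) (Rabs_pos_lt _ E)) as (d & Hd & Hd2).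
  exists (Rmin e d). split; [now apply Rmin_glb_lt|].
  intros y [Hy0 Hy] Hz.
  assert (H1 := Rlt_le_trans _ _ _ Hy (Rmin_l _ _)).
  assert (H2 := Rlt_le_trans _ _ _ Hy (Rmin_r _ _)).
  specialize (Hd2 (y - x)). simpl in Hd2. unfold Rdist in Hd2.
  rewrite (is_pseries_unique _ _ _ (Ha y (conj Hy0 H1))), PSeries_0, Hz, Rminus_0_r in Hd2.
  rewrite Rminus_0_l, Rabs_Ropp in Hd2.
  apply (Rlt_irrefl (Rabs (a 0%nat))), Hd2.
  split; [|exact H2]. split; [exact I|].
  intros Hyx. rewrite <- Hyx, Rabs_R0 in Hy0. lra.
Qed.

(** The index [k] need not be that of the first nonzero coefficient: the induction stops at a
    nonzero constant term, and otherwise divides by [y - x]. *)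
Lemma punctured_nonzero (k : nat) : forall (a : nat -> R) (f : R -> R) (x : R),
  punctured_pseries a f x -> a k <> 0 ->
  exists e, 0 < e /\ forall y, 0 < Rabs (y - x) < e -> f y <> 0.
Proof.
  induction k as [|k IH]; intros a f x Hf Hk; [exact (punctured_nonzero_0 a f x Hf Hk)|].
  destruct (Req_dec (a 0%nat) 0) as [E|E]; [|exact (punctured_nonzero_0 a f x Hf E)].
  destruct Hf as (e & He & Ha).
  destruct (IH (PS_decr_1 a) (fun y => / (y - x) * f y) x) as (d & Hd & Hnz).
  + exists e. split; [exact He|]. intros y Hy.
    assert (Hyx : y - x <> 0) by (intros Hyx; rewrite Hyx, Rabs_R0 in Hy; lra).
    assert (H := is_pseries_decr_1 a (y - x) (/ (y - x)) (f y) (Rinv_l _ Hyx) (Ha y Hy)).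
    rewrite E in H. replace (/ (y - x) * f y) with (scal (/ (y - x)) (plus (f y) (opp 0))); [exact H|].
    unfold scal, plus, opp; simpl; unfold mult; simpl. ring.
  + exact Hk.
  + exists (Rmin e d). split; [now apply Rmin_glb_lt|].
    intros y [Hy0 Hy] Hz. apply (Hnz y).
    * split; [exact Hy0|]. exact (Rlt_le_trans _ _ _ Hy (Rmin_r _ _)).
    * rewrite Hz. ring.
Qed.

Lemma laurent_isolated (f : R -> R) (x : R) :
  laurent_real f x -> punctured_zero f x \/
  exists e, 0 < e /\ forall y, 0 < Rabs (y - x) < e -> f y <> 0.
Proof.
  intros (k & a & Hf).
  destruct (classic (exists j, a j <> 0)) as [[j Hj]|Hno].
  - right. destruct (punctured_nonzero j _ _ _ Hf Hj) as (e & He & H).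
    exists e. split; [exact He|]. intros y Hy Hz. apply (H y Hy). rewrite Hz. ring.
  - left. destruct Hf as (e & He & H). exists e. split; [exact He|].
    intros y Hy. assert (H1 := is_pseries_unique _ _ _ (H y Hy)).
    assert (Hyx : y - x <> 0) by (intros Hyx; rewrite Hyx, Rabs_R0 in Hy; lra).
    assert (E : PSeries a (y - x) = 0).
    { rewrite (PSeries_ext a (fun _ => 0)).
      - apply PSeries_const_0.
      - intros n. destruct (Req_dec (a n) 0); [assumption|]. exfalso. eauto. }
    rewrite E in H1. symmetry in H1. apply Rmult_integral in H1.
    destruct H1 as [H1|H1]; [|exact H1]. exfalso. apply (pow_nonzero _ k Hyx), H1.
Qed.

(* At the supremum of the points near which [f] does not vanish, [f] vanishes
   at points accumulating from the right. *)
Lemma laurent_identity (f : R -> R) (lo c : R) :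
  (forall x, lo < x -> laurent_real f x) -> (forall y, c < y -> f y = 0) ->
  forall x, lo < x -> punctured_zero f x.
Proof.
  intros HL Hz x Hx. apply NNPP. intros Hbad.
  set (E := fun z => x <= z /\ ~ punctured_zero f z).
  assert (Hc : forall z, E z -> z <= c).
  { intros z [_ Hb]. destruct (Rle_dec z c) as [h|h]; [exact h|]. exfalso. apply Hb.
    exists (z - c). split; [lra|]. intros y Hy. apply Hz.
    assert (H := proj2 Hy). apply Rabs_def2 in H. lra. }
  destruct (completeness E) as [s [Hub Hlub]].
  { exists c. exact Hc. }
  { exists x. split; [lra|exact Hbad]. }
  assert (Hxs : x <= s) by (apply Hub; split; [lra|exact Hbad]).
  (* If [f] vanishes around [s], then [s - e] already bounds the bad points, against minimality of
     [s]. Otherwise [f] has no zero just to the right of [s], although every point there is beyond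
     the supremum and so good. *)
  destruct (laurent_isolated f s (HL s ltac:(lra))) as [(e & He & H)|(e & He & H)].
  - assert (Hs : s <= s - e); [|lra]. apply Hlub. intros z Hz'.
    destruct (Rle_dec z (s - e)) as [h|h]; [exact h|]. exfalso.
    assert (Hzs := Hub z Hz'). apply (proj2 Hz').
    destruct (Req_dec z s) as [->|Hne]; [exists e; auto|].
    exists (Rmin (s - z) (z - (s - e))). split; [apply Rmin_glb_lt; lra|].
    intros y [_ Hy]. assert (H1 := Rlt_le_trans _ _ _ Hy (Rmin_l _ _)).
    assert (H2 := Rlt_le_trans _ _ _ Hy (Rmin_r _ _)).
    apply Rabs_def2 in H1. apply Rabs_def2 in H2.
    apply H. split; [apply Rabs_pos_lt; lra | apply Rabs_def1; lra].
  - assert (Hg : punctured_zero f (s + e / 2)).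
    { apply NNPP. intros Hn. assert (Hn' := Hub (s + e / 2)).
      assert (s + e / 2 <= s); [|lra]. apply Hn'. split; [lra|exact Hn]. }
    destruct Hg as (d & Hd & Hg).
    assert (Hm : 0 < Rmin d (e / 2)) by (apply Rmin_glb_lt; lra).
    assert (H1 := Rmin_l d (e / 2)). assert (H2 := Rmin_r d (e / 2)).
    (* Off the centre [s + e / 2], where nothing is known about [f], yet within [d] of it and within
       [e] of [s]. *)
    set (y := s + e / 2 + Rmin d (e / 2) / 2).
    apply (H y); [|apply Hg]; unfold y; split;
      try (apply Rabs_pos_lt; lra); apply Rabs_def1; lra.
Qed.

(** * Continuation of the series over one residue class *)

Ltac eq_in_R := match goal with |- @eq _ ?x ?y => change (@eq R x y) end.

(** Taylor coefficients of [(1 - exp (- m t)) / t]. The constant one is [m], the divisor in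
    [taylor_coef]. *)
Definition denom_coef (m : R) (k : nat) : R := - ((- m) ^ S k / INR (fact (S k))).

(* Taylor coefficients at 0 of [taylor_rem b m N t * ((1 - exp (- m t)) / t)], see
   [is_pseries_taylor_rem]; they are defined first because the recursion of [taylor_rem]
   removes the value at 0, which is [taylor_coef b m N]. *)
Fixpoint rem_coef (b m : R) (N k : nat) : R :=
  match N with
  | O => (- b) ^ k / INR (fact k)
  | S N => rem_coef b m N (S k) - rem_coef b m N 0 / m * denom_coef m (S k)
  end.

Definition taylor_coef (b m : R) (N : nat) : R := rem_coef b m N 0 / m.

(** For [N = 0] this is a generating function of Bernoulli polynomials: its [j]th Taylor coefficient
    is [m ^ (j - 1) * B_j (1 - b / m) / j!]. Only [t > 0] is meaningful. *)
Fixpoint taylor_rem (b m : R) (N : nat) (t : R) : R :=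
  match N with
  | O => t * exp (- (b * t)) / (1 - exp (- (m * t)))
  | S N => (taylor_rem b m N t - taylor_coef b m N) / t
  end.

Lemma is_pseries_exp_scal (c t : R) :
  is_pseries (fun k => c ^ k / INR (fact k)) t (exp (c * t)).
Proof.
  apply is_pseries_R. apply is_series_ext with (2 := is_series_exp (c * t)).
  intros j. eq_in_R. rewrite Rpow_mult_distr. field. apply Rgt_not_eq, INR_fact_pos.
Qed.

Lemma is_pseries_denom_coef (m t : R) :
  t <> 0 -> is_pseries (denom_coef m) t ((1 - exp (- (m * t))) / t).
Proof.
  intros Ht.
  assert (H := is_pseries_decr_1 _ t (/ t) _ (Rinv_l t Ht) (is_pseries_exp_scal (- m) t)).
  apply (is_pseries_scal_R (-1)) in H.
  unfold scal, plus, opp in H; simpl in H; unfold mult in H; simpl in H.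
  replace ((1 - exp (- (m * t))) / t) with (-1 * (/ t * (exp (- m * t) + - (1 / 1)))).
  - apply is_pseries_ext with (2 := H).
    intros k. eq_in_R. unfold PS_scal, PS_decr_1, denom_coef, scal; simpl; unfold mult; simpl. ring.
  - replace (- m * t) with (- (m * t)) by ring. field. exact Ht.
Qed.

Lemma exp_lt_1 (x : R) : x < 0 -> exp x < 1.
Proof. intros Hx. rewrite <- exp_0. now apply exp_increasing. Qed.

(** Multiplied by the denominator, one step of [taylor_rem] subtracts a multiple of the denominator
    series and divides by [t]. The constant term cancels because [denom_coef m 0] is [m]. Thus the
    expansion converges for every [t > 0], whereas that of [taylor_rem] itself is limited by the
    complex zeros of [1 - exp (- m t)]. *)
Lemma is_pseries_taylor_rem (b m : R) (N : nat) (t : R) :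
  0 < m -> 0 < t ->
  is_pseries (rem_coef b m N) t (taylor_rem b m N t * ((1 - exp (- (m * t))) / t)).
Proof.
  intros Hm Ht.
  assert (He : exp (- (m * t)) < 1) by (apply exp_lt_1; nra).
  induction N as [|N IH].
  - simpl. replace (t * exp (- (b * t)) / (1 - exp (- (m * t))) * ((1 - exp (- (m * t))) / t))
      with (exp (- b * t)).
    + apply is_pseries_exp_scal.
    + replace (- b * t) with (- (b * t)) by ring. field. split; lra.
  - assert (H1 := is_pseries_plus _ _ _ _ _ IH
      (is_pseries_scal_R (- taylor_coef b m N) _ _ _ (is_pseries_denom_coef m t ltac:(lra)))).
    assert (H2 := is_pseries_decr_1 _ t (/ t) _ (Rinv_l t ltac:(lra)) H1).
    unfold scal, plus, opp in H2; simpl in H2; unfold mult in H2; simpl in H2.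
    match type of H2 with is_pseries _ _ ?l => replace (taylor_rem b m (S N) t * ((1 - exp (- (m * t))) / t)) with l end.
    + apply is_pseries_ext with (2 := H2). intros k.
      unfold PS_decr_1, PS_plus, PS_scal, plus, scal, taylor_coef; simpl; unfold mult; simpl. ring.
    + unfold PS_plus, PS_scal, plus, scal, taylor_coef, denom_coef; simpl; unfold mult, taylor_coef; simpl. field. lra.
Qed.

Lemma one_minus_exp_ge (m t : R) :
  1 <= m -> 0 < t -> t * exp (- t) <= 1 - exp (- (m * t)).
Proof.
  intros Hm Ht.
  assert (H1 : exp (- (m * t)) <= exp (- t)).
  { destruct (Req_dec m 1) as [->|H]; [rewrite Rmult_1_l; lra|].
    left. apply exp_increasing. nra. }
  assert (H2 := exp_ineq1_le t).
  assert (H3 : exp (- t) * exp t = 1) by (rewrite <- exp_plus, Rplus_opp_l; apply exp_0).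
  assert (H4 := exp_pos (- t)). nra.
Qed.

(** The power series of the product is continuous, hence bounded, on the closed interval from 0 to
    1, and the factor [(1 - exp (- (m * t))) / t] is at least [exp (- 1)] there, so it can be
    divided out. *)
Lemma taylor_rem_bounded_near_0 (b m : R) (N : nat) :
  1 <= m -> exists C, forall t, 0 < t <= 1 -> Rabs (taylor_rem b m N t) <= C.
Proof.
  intros Hm.
  set (U := PSeries (rem_coef b m N)).
  assert (HC : forall c, 0 <= c <= 1 -> continuity_pt (fun t => Rabs (U t)) c).
  { intros c Hc. apply (continuity_pt_comp U Rabs); [|apply Rcontinuity_abs].
    apply PSeries_continuity. apply Rbar_lt_le_trans with 2.
    - simpl. rewrite Rabs_pos_eq; lra.
    - assert (H := radius_ge _ _ _ (is_pseries_taylor_rem b m N 2 ltac:(lra) ltac:(lra))).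
      rewrite Rabs_pos_eq in H by lra. exact H. }
  destruct (continuity_ab_maj _ 0 1 ltac:(lra) HC) as (t0 & Hmax & _).
  exists (Rabs (U t0) * exp 1). intros t Ht.
  specialize (Hmax t ltac:(lra)). cbv beta in Hmax.
  unfold U at 1 in Hmax.
  rewrite (is_pseries_unique _ _ _ (is_pseries_taylor_rem b m N t ltac:(lra) ltac:(lra))) in Hmax.
  assert (Hq : exp (- (1)) <= (1 - exp (- (m * t))) / t).
  { apply Rle_trans with (exp (- t)).
    - destruct (Req_dec t 1) as [->|H]; [lra|]. left. apply exp_increasing. lra.
    - apply Rmult_le_reg_r with t; [lra|]. unfold Rdiv. rewrite Rmult_assoc, Rinv_l, Rmult_1_r by lra.
      rewrite Rmult_comm. apply one_minus_exp_ge; lra. }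
  assert (He := exp_pos (- (1))). assert (He1 := exp_pos 1).
  assert (E : exp (- (1)) * exp 1 = 1) by (rewrite <- exp_plus, Rplus_opp_l; apply exp_0).
  rewrite Rabs_mult, (Rabs_pos_eq (_ / _)) in Hmax by lra.
  assert (Hx := Rabs_pos (taylor_rem b m N t)).
  apply Rle_trans with (Rabs (taylor_rem b m N t) * (exp (- (1)) * exp 1)); [rewrite E; lra|].
  rewrite <- Rmult_assoc. apply Rmult_le_compat_r; [lra|].
  apply Rle_trans with (2 := Hmax). apply Rmult_le_compat_l; lra.
Qed.

(** Linear growth is the true order for [N = 0] and [b = 0], and it is preserved by the
    recursion. *)
Lemma taylor_rem_linear_bound (b m : R) (N : nat) :
  0 <= b -> 1 <= m -> exists C, forall t, 1 <= t -> Rabs (taylor_rem b m N t) <= C * t.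
Proof.
  intros Hb Hm. induction N as [|N [C IH]].
  - exists (exp 1). intros t Ht. simpl.
    assert (H := one_minus_exp_ge m 1 Hm ltac:(lra)).
    assert (He := exp_pos (- (1))). assert (He1 := exp_pos 1).
    assert (E : exp (- (1)) * exp 1 = 1) by (rewrite <- exp_plus, Rplus_opp_l; apply exp_0).
    assert (H1 : exp (- (m * t)) <= exp (- (m * 1))).
    { destruct (Req_dec t 1) as [->|Hn]; [lra|]. left. apply exp_increasing. nra. }
    assert (H2 : exp (- (b * t)) <= 1).
    { destruct (Req_dec b 0) as [->|Hn].
      - rewrite Rmult_0_l, Ropp_0, exp_0. lra.
      - left. apply exp_lt_1. nra. }
    assert (H3 := exp_pos (- (b * t))).
    rewrite Rabs_pos_eq.
    + apply Rmult_le_reg_r with (1 - exp (- (m * t))); [lra|].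
      unfold Rdiv. rewrite Rmult_assoc, Rinv_l, Rmult_1_r by lra.
      apply Rle_trans with (exp 1 * t * exp (- (1))); [|apply Rmult_le_compat_l; nra].
      replace (exp 1 * t * exp (- (1))) with (t * (exp (- (1)) * exp 1)) by ring. rewrite E. nra.
    + apply Rmult_le_pos; [nra|]. apply Rlt_le, Rinv_0_lt_compat. lra.
  - exists (C + Rabs (taylor_coef b m N)). intros t Ht. simpl.
    unfold Rdiv. rewrite Rabs_mult, (Rabs_pos_eq (/ t)) by (apply Rlt_le, Rinv_0_lt_compat; lra).
    apply Rmult_le_reg_r with t; [lra|]. rewrite Rmult_assoc, Rinv_l, Rmult_1_r by lra.
    eapply Rle_trans; [apply Rabs_triang|]. rewrite Rabs_Ropp.
    specialize (IH t Ht). assert (H0 := Rabs_pos (taylor_coef b m N)).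
    assert (H1 := Rabs_pos (taylor_rem b m N t)).
    assert (H2 : C * t * 1 <= C * t * t) by (apply Rmult_le_compat_l; lra).
    assert (H3 : Rabs (taylor_coef b m N) * 1 <= Rabs (taylor_coef b m N) * (t * t)) by (apply Rmult_le_compat_l; nra).
    lra.
Qed.

Lemma cont_pos_taylor_rem (b m : R) (N : nat) : 0 < m -> cont_pos (taylor_rem b m N).
Proof.
  intros Hm. induction N as [|N IH]; intros t Ht; simpl.
  - apply (ex_derive_continuous (V := R_NormedModule)).
    assert (exp (- (m * t)) < 1) by (apply exp_lt_1; nra).
    auto_derive. lra.
  - apply (continuous_mult (K := R_AbsRing) (fun t => taylor_rem b m N t - taylor_coef b m N) (fun t => / t)).
    + apply (continuous_minus (V := R_NormedModule)); [apply IH, Ht|apply continuous_const].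
    + apply continuous_Rinv. lra.
Qed.

(** The [h] of the overview; [p] is the index of the last Taylor coefficient removed. *)
Definition mellin_rem (b m : R) (p : nat) (t : R) : R := exp (- t) * taylor_rem b m (S p) t.

Lemma expo_bounded_mellin_rem (b m : R) (p : nat) :
  0 <= b -> 1 <= m -> expo_bounded (mellin_rem b m p).
Proof.
  intros Hb Hm. split.
  - apply cont_pos_mult; [apply cont_pos_expN|apply cont_pos_taylor_rem; lra].
  - destruct (taylor_rem_bounded_near_0 b m (S p) Hm) as [C1 H1].
    (* Taken at [p], not at [S p]: the last division by [t] turns the linear bound into a constant
       one. *)
    destruct (taylor_rem_linear_bound b m p Hb Hm) as [C2 H2].
    exists (Rmax C1 (C2 + Rabs (taylor_coef b m p))). intros t Ht.
    unfold mellin_rem. rewrite Rabs_mult, (Rabs_pos_eq (exp _)), Rmult_comm by apply Rlt_le, exp_pos.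
    apply Rmult_le_compat_r; [apply Rlt_le, exp_pos|].
    destruct (Rle_dec t 1) as [h|h].
    + eapply Rle_trans; [apply H1; lra|apply Rmax_l].
    + eapply Rle_trans; [|apply Rmax_r]. simpl.
      unfold Rdiv. rewrite Rabs_mult, (Rabs_pos_eq (/ t)) by (apply Rlt_le, Rinv_0_lt_compat; lra).
      apply Rmult_le_reg_r with t; [lra|]. rewrite Rmult_assoc, Rinv_l, Rmult_1_r by lra.
      eapply Rle_trans; [apply Rabs_triang|]. rewrite Rabs_Ropp.
      specialize (H2 t ltac:(lra)). assert (H0 := Rabs_pos (taylor_coef b m p)). nra.
Qed.

Lemma taylor_rem_expand (b m : R) (p : nat) (t : R) : 0 < t ->
  taylor_rem b m 0 t = sum_n (fun j => taylor_coef b m j * t ^ j) p + t ^ S p * taylor_rem b m (S p) t.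
Proof.
  intros Ht.
  assert (E : forall N, taylor_rem b m N t = taylor_coef b m N + t * taylor_rem b m (S N) t).
  { intros N. change (taylor_rem b m (S N) t) with ((taylor_rem b m N t - taylor_coef b m N) / t). field. lra. }
  induction p as [|p IH].
  - rewrite sum_O, (E 0%nat). ring.
  - rewrite sum_Sn, IH, (E (S p)). unfold plus; simpl. ring.
Qed.

(** The rising factorial, or Pochhammer symbol, [z (z + 1) ... (z + j - 1)]. *)
Fixpoint rise (j : nat) (z : R) : R :=
  match j with O => 1 | S j => rise j z * (z + INR j) end.

Lemma gam_rise (j : nat) (z : R) : 0 < z -> gam (z + INR j) = rise j z * gam z.
Proof.
  intros Hz. induction j as [|j IH].
  - simpl. rewrite Rplus_0_r. ring.
  - rewrite S_INR, <- Rplus_assoc, gam_succ, IH.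
    + simpl. ring.
    + assert (H := pos_INR j). lra.
Qed.

Lemma rise_pos (j : nat) (z : R) : 0 < z -> 0 < rise j z.
Proof.
  intros Hz. induction j as [|j IH]; simpl; [lra|].
  apply Rmult_lt_0_compat; [exact IH|]. assert (H := pos_INR j). lra.
Qed.

Lemma is_lim_seq_Rpower_neg (s : R) : 0 < s -> is_lim_seq (fun J => Rpower (INR (S J)) (- s)) 0.
Proof.
  intros Hs. unfold Rpower.
  apply filterlim_comp with (G := Rbar_locally m_infty) (f := fun J => - s * ln (INR (S J))) (g := exp).
  - assert (H : is_lim_seq (fun J => ln (INR (S J))) p_infty).
    { apply filterlim_comp with (G := Rbar_locally p_infty) (f := fun J => INR (S J)) (g := ln).
      - apply (is_lim_seq_incr_1 INR p_infty), is_lim_seq_INR.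
      - apply is_lim_ln_p. }
    assert (H2 := is_lim_seq_scal_l _ (- s) _ H).
    replace (Rbar_mult (- s) p_infty) with m_infty in H2; [exact H2|].
    simpl. destruct Rle_dec as [h|h]; [|reflexivity]. exfalso. lra.
  - apply is_lim_exp_m.
Qed.

(* Equal to [exp (- (b + 1) t) / (1 - exp (- m t))], the sum over [i] of
   [exp (- (b + 1 + m i) t)]. *)
Definition residue_sum (b m t : R) : R := exp (- t) * taylor_rem b m 0 t / t.

(** The factor [1 / t] in [residue_sum] lowers every exponent by one: the Gamma arguments start at
    [s - 1], whence [1 < s], and the remainder of order [p + 1] is transformed at [s + p]. *)
Lemma residue_sum_integral (b m s : R) (p : nat) :
  0 <= b -> 1 <= m -> 1 < s ->
  integral0oo (fun t => Rpower t (s - 1) * residue_sum b m t)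
    (sum_n (fun j => taylor_coef b m j * gam (s - 1 + INR j)) p + mellin (mellin_rem b m p) (s + INR p)).
Proof.
  intros Hb Hm Hs.
  assert (Hp := pos_INR p).
  assert (I1 := integral0oo_sum _ _ p (fun j _ => integral0oo_scal (taylor_coef b m j) _ _
    (is_gam (s - 1 + INR j) ltac:(assert (H := pos_INR j); lra)))).
  assert (I2 := is_mellin _ (s + INR p) (expo_bounded_mellin_rem b m p Hb Hm) ltac:(lra)).
  apply integral0oo_ext with (2 := integral0oo_plus _ _ _ _ I1 I2).
  intros t Ht. cbv beta. unfold residue_sum. rewrite (taylor_rem_expand b m p t Ht).
  assert (E : forall k : nat, Rpower t (s - 1 + INR k - 1) = Rpower t (s - 1) * t ^ k / t).
  { intros k. replace (s - 1 + INR k - 1) with (s - 1 + INR k + - (1)) by ring.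
    rewrite !Rpower_plus, Rpower_pow, Rpower_Ropp, Rpower_1 by exact Ht. reflexivity. }
  replace (s + INR p - 1) with (s - 1 + INR (S p) - 1) by (rewrite S_INR; ring).
  rewrite E. unfold mellin_rem.
  replace (sum_n (fun i => taylor_coef b m i * (Rpower t (s - 1 + INR i - 1) * exp (- t))) p)
    with (Rpower t (s - 1) * exp (- t) / t * sum_n (fun j => taylor_coef b m j * t ^ j) p).
  - field. lra.
  - rewrite <- (sum_n_mult_l (K := R_Ring)). apply sum_n_ext. intros j.
    rewrite E. unfold mult; simpl. field. lra.
Qed.

(** Each exponential is [residue_sum] times a difference of consecutive powers of [exp (- (m * t))],
    so the sum telescopes and the error is exact. *)
Lemma geometric_tail (b m t : R) (J : nat) :
  0 < m -> 0 < t ->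
  sum_n (fun i => exp (- ((b + 1 + m * INR i) * t))) J =
  residue_sum b m t - residue_sum b m t * exp (- (m * INR (S J) * t)).
Proof.
  intros Hm Ht.
  assert (He : exp (- (m * t)) < 1) by (apply exp_lt_1; nra).
  assert (E : forall J, exp (- ((b + 1 + m * INR J) * t)) =
    residue_sum b m t * (exp (- (m * INR J * t)) - exp (- (m * INR (S J) * t)))).
  { intros j. unfold residue_sum. simpl taylor_rem.
    replace (- (m * INR (S j) * t)) with (- (m * INR j * t) + - (m * t)) by (rewrite S_INR; ring).
    replace (- ((b + 1 + m * INR j) * t)) with (- t + - (b * t) + - (m * INR j * t)) by ring.
    rewrite !exp_plus. field. split; lra. }
  induction J as [|J IH].
  - rewrite sum_O, E. simpl. rewrite Rmult_0_r, Rmult_0_l, Ropp_0, exp_0. ring.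
  - rewrite sum_Sn, IH, E. unfold plus; simpl. ring.
Qed.

Lemma residue_sum_bound (b m t : R) :
  0 <= b -> 1 <= m -> 0 < t -> 0 <= residue_sum b m t <= / t.
Proof.
  intros Hb Hm Ht. unfold residue_sum. simpl.
  assert (H := one_minus_exp_ge m t Hm Ht).
  assert (H0 := exp_pos (- t)). assert (H1 := exp_pos (- (b * t))).
  assert (H2 : exp (- (b * t)) <= 1).
  { destruct (Req_dec b 0) as [->|Hn].
    - rewrite Rmult_0_l, Ropp_0, exp_0. lra.
    - left. apply exp_lt_1. nra. }
  assert (H3 : 0 < 1 - exp (- (m * t))) by nra.
  replace (exp (- t) * (t * exp (- (b * t)) / (1 - exp (- (m * t)))) / t)
    with (exp (- t) * exp (- (b * t)) / (1 - exp (- (m * t)))) by (field; lra).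
  split.
  - apply Rmult_le_pos; [nra|]. apply Rlt_le, Rinv_0_lt_compat, H3.
  - apply Rmult_le_reg_r with (t * (1 - exp (- (m * t)))); [nra|].
    replace (exp (- t) * exp (- (b * t)) / (1 - exp (- (m * t))) * (t * (1 - exp (- (m * t)))))
      with (t * exp (- t) * exp (- (b * t))) by (field; lra).
    replace (/ t * (t * (1 - exp (- (m * t))))) with (1 - exp (- (m * t))) by (field; lra).
    apply Rle_trans with (t * exp (- t)); [|exact H].
    rewrite <- (Rmult_1_r (t * exp (- t))) at 2. apply Rmult_le_compat_l; nra.
Qed.

(** Each term times [gam s] is a Mellin integral of an exponential. Since [residue_sum] is at most
    [1 / t] and [m >= 1], the integrated geometric tail is at most
    [(J + 1) ^ (- (s - 1)) * gam (s - 1)], which tends to 0. *)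
Lemma hurwitz_sum (b m s : R) (p : nat) :
  0 <= b -> 1 <= m -> 1 < s ->
  is_lim_seq (sum_n (fun i => Rpower (b + 1 + m * INR i) (- s)))
    ((sum_n (fun j => taylor_coef b m j * gam (s - 1 + INR j)) p + mellin (mellin_rem b m p) (s + INR p)) / gam s).
Proof.
  intros Hb Hm Hs.
  set (V := sum_n (fun j => taylor_coef b m j * gam (s - 1 + INR j)) p + mellin (mellin_rem b m p) (s + INR p)).
  assert (HV := residue_sum_integral b m s p Hb Hm Hs). fold V in HV.
  assert (Hg := gam_pos s ltac:(lra)).
  apply is_lim_seq_bound with (fun J => Rpower (INR (S J)) (- (s - 1)) * (gam (s - 1) / gam s)).
  - intros J.
    assert (I1 := integral0oo_sum _ _ J (fun i _ => gam_scale s (b + 1 + m * INR i) ltac:(lra)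
      ltac:(assert (H := pos_INR i); nra))).
    assert (I2 := integral0oo_minus _ _ _ _ I1 HV).
    assert (I3 := gam_scale (s - 1) (INR (S J)) ltac:(lra) (lt_0_INR _ (Nat.lt_0_succ J))).
    assert (E : sum_n (fun i => Rpower (b + 1 + m * INR i) (- s) * gam s) J =
      sum_n (fun i => Rpower (b + 1 + m * INR i) (- s)) J * gam s)
      by apply (sum_n_mult_r (K := R_Ring)).
    rewrite E in I2.
    assert (HB : Rabs (sum_n (fun i => Rpower (b + 1 + m * INR i) (- s)) J * gam s - V) <=
      Rpower (INR (S J)) (- (s - 1)) * gam (s - 1)).
    { refine (integral0oo_bound _ _ _ _ _ I2 I3). intros t Ht. cbv beta.
      replace (sum_n (fun i => Rpower t (s - 1) * exp (- ((b + 1 + m * INR i) * t))) J)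
        with (Rpower t (s - 1) * sum_n (fun i => exp (- ((b + 1 + m * INR i) * t))) J)
        by (symmetry; apply (sum_n_mult_l (K := R_Ring))).
      rewrite geometric_tail by lra.
      match goal with |- Rabs ?l <= _ => replace l with
        (- (Rpower t (s - 1) * residue_sum b m t * exp (- (m * INR (S J) * t)))) by ring end.
      destruct (residue_sum_bound b m t Hb Hm Ht) as [B1 B2].
      assert (H1 := Rpower_pos t (s - 1)).
      assert (H2 := exp_pos (- (m * INR (S J) * t))).
      rewrite Rabs_Ropp, Rabs_pos_eq by (apply Rmult_le_pos; [apply Rmult_le_pos|]; lra).
      replace (Rpower t (s - 1 - 1)) with (Rpower t (s - 1) * / t)
        by (replace (s - 1 - 1) with (s - 1 + - (1)) by ring; rewrite (Rpower_plus (s - 1)), Rpower_Ropp, Rpower_1; auto).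
      apply Rmult_le_compat; [nra|lra| |].
      - apply Rmult_le_compat_l; lra.
      - assert (HJ := lt_0_INR _ (Nat.lt_0_succ J)).
        destruct (Req_dec m 1) as [->|Hn]; [rewrite Rmult_1_l; lra|].
        left. apply exp_increasing.
        assert (0 < INR (S J) * t) by nra. nra. }
    apply Rmult_le_reg_r with (gam s); [exact Hg|].
    rewrite <- (Rabs_pos_eq (gam s)) at 2 by lra. rewrite <- Rabs_mult.
    replace ((sum_n (fun i => Rpower (b + 1 + m * INR i) (- s)) J - V / gam s) * gam s)
      with (sum_n (fun i => Rpower (b + 1 + m * INR i) (- s)) J * gam s - V) by (field; lra).
    eapply Rle_trans; [exact HB|]. right. field. lra.
  - replace (Finite 0) with (Rbar_mult 0 (gam (s - 1) / gam s)) by (simpl; f_equal; ring).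
    apply is_lim_seq_mult'; [|apply is_lim_seq_const].
    apply is_lim_seq_Rpower_neg. lra.
Qed.

Definition poly_part (b m : R) (p : nat) (s : R) : R :=
  sum_n (fun j => taylor_coef b m j * rise j (s - 1)) p.

(** The functional equation expresses every Gamma value through [gam (s - 1)], which cancels. What
    remains involves [gam] and [mellin] only at [s + p], where the integrals converge as long as
    [s > - p]. *)
Lemma hurwitz_continuation (b m s : R) (p : nat) :
  0 <= b -> 1 <= m -> 1 < s ->
  is_lim_seq (sum_n (fun i => Rpower (b + 1 + m * INR i) (- s)))
    ((gam (s + INR p) * poly_part b m p s +
      rise (S p) (s - 1) * mellin (mellin_rem b m p) (s + INR p)) / ((s - 1) * gam (s + INR p))).
Proof.
  intros Hb Hm Hs.
  match goal with |- is_lim_seq _ (Finite ?l) => replace l with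
    ((sum_n (fun j => taylor_coef b m j * gam (s - 1 + INR j)) p + mellin (mellin_rem b m p) (s + INR p)) / gam s) end.
  { apply hurwitz_sum; assumption. }
  assert (Hg := gam_pos (s - 1) ltac:(lra)).
  assert (Hr := rise_pos (S p) (s - 1) ltac:(lra)).
  assert (E0 : gam s = (s - 1) * gam (s - 1)).
  { rewrite <- gam_succ by lra. f_equal. ring. }
  assert (E1 : gam (s + INR p) = rise (S p) (s - 1) * gam (s - 1)).
  { rewrite <- gam_rise by lra. f_equal. rewrite S_INR. ring. }
  assert (E2 : sum_n (fun j => taylor_coef b m j * gam (s - 1 + INR j)) p = poly_part b m p s * gam (s - 1)).
  { unfold poly_part. symmetry. rewrite <- (sum_n_mult_r (K := R_Ring)).
    apply sum_n_ext. intros j. unfold mult; simpl. rewrite gam_rise by lra. ring. }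
  rewrite E0, E1, E2. field. lra.
Qed.

(** * Continuation of a periodic Dirichlet series *)

Lemma sum_n_shift (f : nat -> R) (N k : nat) :
  sum_n f (N + S k) = sum_n f N + sum_n (fun b => f (S N + b)%nat) k.
Proof.
  induction k as [|k IH].
  - rewrite Nat.add_1_r, sum_Sn, sum_O, Nat.add_0_r. reflexivity.
  - rewrite <- plus_n_Sm, !sum_Sn, IH. unfold plus; simpl.
    rewrite plus_n_Sm. ring.
Qed.

(** As [sum_n] includes its upper index, [J * S m + m] closes exactly [J + 1] periods of length
    [S m]. *)
Lemma sum_n_residues (f : nat -> R) (m J : nat) :
  sum_n f (J * S m + m) = sum_n (fun b => sum_n (fun i => f (i * S m + b)%nat) J) m.
Proof.
  induction J as [|J IH].
  - apply sum_n_ext. intros b. now rewrite sum_O.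
  - replace (S J * S m + m)%nat with (J * S m + m + S m)%nat by (simpl; lia).
    rewrite sum_n_shift, IH.
    transitivity (sum_n (fun b => plus (sum_n (fun i => f (i * S m + b)%nat) J) (f (S J * S m + b)%nat)) m).
    + rewrite (sum_n_plus (G := R_AbelianMonoid)).
      apply f_equal2; [reflexivity|]. apply sum_n_ext. intros b. f_equal. simpl; lia.
    + apply sum_n_ext. intros b. now rewrite sum_Sn.
Qed.

Lemma is_lim_seq_sum (f : nat -> nat -> R) (l : nat -> R) (N : nat) :
  (forall i, is_lim_seq (f i) (l i)) ->
  is_lim_seq (fun J => sum_n (fun i => f i J) N) (sum_n l N).
Proof.
  intros H. induction N as [|N IH].
  - rewrite sum_O. apply is_lim_seq_ext with (2 := H 0%nat). intros. now rewrite sum_O.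
  - rewrite sum_Sn. apply is_lim_seq_ext with (fun J => sum_n (fun i => f i J) N + f (S N) J).
    + intros. now rewrite sum_Sn.
    + apply is_lim_seq_plus'; auto.
Qed.

(** Only the partial sums over whole periods are regrouped, and these form a subsequence, so no
    rearrangement of an infinite series takes place. Position [j] carries the integer [j + 1], so
    [b] stands for the residue [b + 1]. *)
Lemma dirichlet_series_residues (c : nat -> R) (m : nat) (s l : R) (z : nat -> R) :
  (forall i b, c (i * S m + b)%nat = c b) ->
  is_series (fun j => c j * Rpower (INR (S j)) (- s)) l ->
  (forall b, is_lim_seq (sum_n (fun i => Rpower (INR b + 1 + INR (S m) * INR i) (- s))) (z b)) ->
  l = sum_n (fun b => c b * z b) m.
Proof.
  intros Hc Hl Hz.
  set (f := fun j => c j * Rpower (INR (S j)) (- s)) in *.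
  assert (H1 : is_lim_seq (fun J => sum_n f (J * S m + m)) l).
  { apply (is_lim_seq_subseq (sum_n f) l (fun J => J * S m + m)%nat); [|exact Hl].
    apply eventually_subseq. intros n. simpl; lia. }
  assert (H2 : is_lim_seq (fun J => sum_n f (J * S m + m)) (sum_n (fun b => c b * z b) m)).
  { apply is_lim_seq_ext with (fun J => sum_n (fun b =>
      c b * sum_n (fun i => Rpower (INR b + 1 + INR (S m) * INR i) (- s)) J) m).
    - intros J. rewrite sum_n_residues. apply sum_n_ext. intros b.
      rewrite <- (sum_n_mult_l (K := R_Ring)). apply sum_n_ext. intros i.
      change (c b * Rpower (INR b + 1 + INR (S m) * INR i) (- s) =
        c (i * S m + b)%nat * Rpower (INR (S (i * S m + b))) (- s)).
      rewrite Hc. do 2 f_equal. rewrite <- mult_INR, <- S_INR, <- plus_INR. f_equal. lia.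
    - apply (is_lim_seq_sum (fun b J => c b * sum_n (fun i => Rpower (INR b + 1 + INR (S m) * INR i) (- s)) J)).
      intros b. apply (is_lim_seq_scal_l _ (c b) (z b)), Hz. }
  apply is_lim_seq_unique in H1. apply is_lim_seq_unique in H2. congruence.
Qed.

Lemma analytic_rise (j : nat) (c x : R) : analytic_real (fun s => rise j (s + c)) x.
Proof.
  induction j as [|j IH]; [apply (analytic_const 1)|].
  apply (analytic_mult (fun s => rise j (s + c)) (fun s => s + c + INR j)); [exact IH|].
  destruct (analytic_affine (c + INR j) x) as [a Ha]. exists a.
  apply filter_imp with (2 := Ha). intros y Hy. now rewrite Rplus_assoc.
Qed.

Lemma analytic_poly_part (b m : R) (p : nat) (x : R) : analytic_real (poly_part b m p) x.
Proof.
  apply (analytic_sum (fun j s => taylor_coef b m j * rise j (s - 1))). intros j.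
  apply analytic_mult; [apply analytic_const|apply (analytic_rise j (- (1)))].
Qed.

(* [(s - 1)] times the sum of [(b + 1 + m i) ^ (- s)], continued to [s > - p]. *)
Definition hurwitz_num (b m : R) (p : nat) (s : R) : R :=
  poly_part b m p s + rise (S p) (s - 1) * (mellin (mellin_rem b m p) (s + INR p) / gam (s + INR p)).

(** The identity theorem is applied to [A * u - B], the equation multiplied by [gam (s + p)], which
    is Laurent at every point of the half-line and zero for [s > 1]. As [gam (s + p)] is positive
    there, it can be divided out afterwards. *)
Lemma continuation_unique (c : nat -> R) (m p : nat) (u : R -> R) :
  (forall i b, c (i * S m + b)%nat = c b) ->
  (forall x, laurent_real u x) ->
  (forall s, 1 < s -> is_series (fun j => c j * Rpower (INR (S j)) (- s)) (u s)) ->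
  forall x, - INR p < x ->
  punctured_zero (fun s => (s - 1) * u s - sum_n (fun b => c b * hurwitz_num (INR b) (INR (S m)) p s) m) x.
Proof.
  intros Hc HL Hu x Hx.
  assert (Hm : 1 <= INR (S m)) by (rewrite S_INR; assert (H := pos_INR m); lra).
  set (M := INR (S m)) in *.
  set (A := fun s => gam (s + INR p) * (s - 1)).
  set (B := fun s => sum_n (fun b => c b * (gam (s + INR p) * poly_part (INR b) M p s +
      rise (S p) (s - 1) * mellin (mellin_rem (INR b) M p) (s + INR p))) m).
  assert (E : forall s, - INR p < s -> A s * u s - B s =
    gam (s + INR p) * ((s - 1) * u s - sum_n (fun b => c b * hurwitz_num (INR b) M p s) m)).
  { intros s Hs. assert (Hg := gam_pos (s + INR p) ltac:(lra)).
    assert (EB : B s = gam (s + INR p) * sum_n (fun b => c b * hurwitz_num (INR b) M p s) m).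
    { unfold B. rewrite <- (sum_n_mult_l (K := R_Ring)). apply sum_n_ext. intros b.
      unfold mult; simpl. unfold hurwitz_num. simpl rise. field. lra. }
    rewrite EB. unfold A. ring. }
  destruct (laurent_identity (fun s => A s * u s - B s) (- INR p) 1) with (x := x) as (e & He & H); auto.
  - intros y Hy. apply laurent_affine; auto.
    + apply analytic_mult.
      * apply analytic_shift, analytic_mellin; [apply expo_bounded_expN|lra].
      * apply analytic_affine.
    + apply (analytic_sum (fun b s => c b * (gam (s + INR p) * poly_part (INR b) M p s +
        rise (S p) (s - 1) * mellin (mellin_rem (INR b) M p) (s + INR p)))).
      intros b. apply analytic_mult; [apply analytic_const|].
      apply analytic_plus; apply analytic_mult.
      * apply analytic_shift, analytic_mellin; [apply expo_bounded_expN|lra].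
      * apply analytic_poly_part.
      * apply (analytic_rise (S p) (- (1))).
      * apply (analytic_shift (mellin (mellin_rem (INR b) M p))), analytic_mellin; [|lra].
        apply expo_bounded_mellin_rem; [apply pos_INR|exact Hm].
  - intros s Hs.
    assert (Hp := pos_INR p). assert (Hg := gam_pos (s + INR p) ltac:(lra)).
    assert (Hus := dirichlet_series_residues c m s (u s) _ Hc (Hu s Hs)
      (fun b => hurwitz_continuation (INR b) M s p (pos_INR b) Hm Hs)).
    rewrite Hus. unfold A, B.
    apply Rminus_diag_eq. rewrite <- (sum_n_mult_l (K := R_Ring)). apply sum_n_ext. intros b.
    unfold mult; simpl. field. split; lra.
  - exists (Rmin e (x + INR p)). split; [apply Rmin_glb_lt; lra|].
    intros y [Hy0 Hy].
    assert (H1 := Rlt_le_trans _ _ _ Hy (Rmin_l _ _)).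
    assert (H2 := Rlt_le_trans _ _ _ Hy (Rmin_r _ _)). apply Rabs_def2 in H2.
    specialize (H y (conj Hy0 H1)). cbv beta in H. rewrite E in H by lra.
    apply Rmult_integral in H. destruct H as [H|H]; [|exact H].
    assert (Hg := gam_pos (y + INR p) ltac:(lra)). lra.
Qed.

(** * Derivative of the continuation at a nonpositive integer *)

Fixpoint drise (j : nat) (z : R) : R :=
  match j with O => 0 | S j => drise j z * (z + INR j) + rise j z end.

Lemma is_derive_rise (j : nat) (c x : R) :
  is_derive (fun s => rise j (s + c)) x (drise j (x + c)).
Proof.
  induction j as [|j IH]; [apply (is_derive_const (V := R_NormedModule) 1)|].
  evar_last.
  - apply (is_derive_mult (K := R_AbsRing) (fun s => rise j (s + c)) (fun s => s + c + INR j)).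
    + exact IH.
    + auto_derive; [exact I|reflexivity].
    + intros; apply Rmult_comm.
  - unfold plus, mult; simpl. ring.
Qed.

Lemma is_derive_sum (f : nat -> R -> R) (d : nat -> R) (N : nat) (x : R) :
  (forall i, is_derive (f i) x (d i)) ->
  is_derive (fun s => sum_n (fun i => f i s) N) x (sum_n d N).
Proof. intros H. apply (is_derive_sum_n (V := R_NormedModule)). intros; apply H. Qed.

(** The quotient rule for [poly_part b m p s / (s - 1)] at [s - 1 = w]. *)
Definition rational_part (b m : R) (p : nat) (w : R) : R :=
  (sum_n (fun j => taylor_coef b m j * drise j w) p * w - sum_n (fun j => taylor_coef b m j * rise j w) p) / w ^ 2.

Lemma analytic_ex_derive (f : R -> R) (x : R) : analytic_real f x -> ex_derive f x.
Proof. intros [a Ha]. exists (a 1%nat). apply analytic_derive, Ha. Qed.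

(** With [p = n + 1], the last factor [s - 1 + p] of [rise (S p) (s - 1)] vanishes at [s = - n]. The
    product rule therefore leaves only the value of the cofactor, taken where [gam] equals 1. *)
Lemma is_derive_hurwitz_num (b m : R) (n : nat) :
  0 <= b -> 1 <= m ->
  is_derive (fun s => hurwitz_num b m (S n) s / (s - 1)) (- INR n)
    (rise (S n) (- INR (S n)) / - INR (S n) * mellin (mellin_rem b m (S n)) 1 +
     rational_part b m (S n) (- INR (S n))).
Proof.
  intros Hb Hm.
  set (p := S n).
  assert (Hn := pos_INR n).
  assert (Ep : INR p = INR n + 1) by apply S_INR.
  clearbody p.
  set (w := - INR p). set (s0 := - INR n).
  assert (Ew : s0 - 1 = w) by (unfold s0, w; lra).
  assert (Ew' : s0 + - (1) = w) by exact Ew.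
  assert (E1 : s0 + INR p = 1) by (unfold s0; lra).
  assert (Ewp : w + INR p = 0) by (unfold w; ring).
  assert (Hw : w <> 0) by (unfold w; lra).
  set (Q := fun s => rise p (s - 1) * (mellin (mellin_rem b m p) (s + INR p) / gam (s + INR p))).
  (* The derivative [q] obtained here is never computed: it ends up multiplied by
     [w + INR p = 0]. *)
  assert (HQ : ex_derive Q s0).
  { apply ex_derive_mult.
    - eexists. apply (is_derive_rise p (- (1))).
    - apply ex_derive_div.
      + apply analytic_ex_derive, (analytic_shift (mellin (mellin_rem b m p))), analytic_mellin; [|lra].
        now apply expo_bounded_mellin_rem.
      + apply analytic_ex_derive, (analytic_shift gam), analytic_mellin; [apply expo_bounded_expN|lra].
      + rewrite E1, gam_1. lra. }
  destruct HQ as [q HQ].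
  assert (HP : is_derive (poly_part b m p) s0 (sum_n (fun j => taylor_coef b m j * drise j w) p)).
  { rewrite <- Ew'. apply (is_derive_sum (fun j s => taylor_coef b m j * rise j (s - 1))). intros j.
    apply (is_derive_scal (fun s => rise j (s - 1))), (is_derive_rise j (- (1))). }
  apply is_derive_ext with (fun s => (poly_part b m p s + (s - 1 + INR p) * Q s) / (s - 1)).
  { intros s. unfold hurwitz_num, Q. change (rise (S p) (s - 1)) with (rise p (s - 1) * (s - 1 + INR p)).
    eq_in_R. unfold Rdiv. ring. }
  evar_last.
  - apply is_derive_div.
    + apply (is_derive_plus (V := R_NormedModule)); [exact HP|].
      apply (is_derive_mult (K := R_AbsRing) (fun s => s - 1 + INR p) Q).
      * auto_derive; [exact I|reflexivity].
      * exact HQ.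
      * intros; apply Rmult_comm.
    + auto_derive; [exact I|reflexivity].
    + rewrite Ew. exact Hw.
  - unfold plus, mult; simpl. rewrite Ew, Ewp. unfold Q, poly_part, rational_part.
    rewrite E1, gam_1, Ew. field. exact Hw.
Qed.

Lemma cont_punctured_eq (f g : R -> R) (x : R) :
  continuous f x -> continuous g x -> punctured_zero (fun y => f y - g y) x -> f x = g x.
Proof.
  intros Hf Hg (e & He & H).
  apply Rminus_diag_uniq. apply NNPP. intros Hne.
  assert (Hc : continuous (fun y => f y - g y) x) by (apply (continuous_minus (V := R_NormedModule)); auto).
  assert (Hl := Hc _ (locally_ball (f x - g x) (mkposreal _ (Rabs_pos_lt _ Hne)))).
  destruct (locally_Rabs_elim _ _ Hl) as (d & Hd & Hb).
  assert (Hmin : 0 < Rmin e d) by (apply Rmin_glb_lt; auto).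
  assert (M1 := Rmin_l e d). assert (M2 := Rmin_r e d).
  assert (Ey : x + Rmin e d / 2 - x = Rmin e d / 2) by ring.
  assert (Z := H (x + Rmin e d / 2)). assert (B := Hb (x + Rmin e d / 2)).
  rewrite Ey, Rabs_pos_eq in Z, B by lra.
  specialize (Z ltac:(lra)). specialize (B ltac:(lra)).
  unfold ball in B; simpl in B; unfold AbsRing_ball, abs, minus, plus, opp in B; simpl in B.
  rewrite Z, Rplus_0_l, Rabs_Ropp in B. lra.
Qed.

(* The derivative at [- n] of the continued sum of [(b + 1 + m i) ^ (- s)]. *)
Definition hurwitz_deriv (b m : R) (n : nat) : R :=
  rise (S n) (- INR (S n)) / - INR (S n) * mellin (mellin_rem b m (S n)) 1 +
  rational_part b m (S n) (- INR (S n)).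

(** The differentiable function is [V], not [u]: at this stage [- n] may still be a pole of [u], so
    the two are compared off [- n] only. *)
Lemma continuation_near (c : nat -> R) (m n : nat) (u : R -> R) :
  (forall i b, c (i * S m + b)%nat = c b) ->
  (forall x, laurent_real u x) ->
  (forall s, 1 < s -> is_series (fun j => c j * Rpower (INR (S j)) (- s)) (u s)) ->
  exists V, punctured_zero (fun s => u s - V s) (- INR n) /\
    is_derive V (- INR n) (sum_n (fun b => c b * hurwitz_deriv (INR b) (INR (S m)) n) m).
Proof.
  intros Hc HL Hu.
  exists (fun s => sum_n (fun b => c b * (hurwitz_num (INR b) (INR (S m)) (S n) s / (s - 1))) m).
  split.
  - destruct (continuation_unique c m (S n) u Hc HL Hu (- INR n)) as (e & He & H).
    { rewrite S_INR. lra. }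
    (* Radius at most 1 around [- n <= 0] keeps [y < 1], so that [y - 1] can be cancelled. *)
    exists (Rmin e 1). split; [apply Rmin_glb_lt; lra|].
    intros y [Hy0 Hy]. assert (H1 := Rlt_le_trans _ _ _ Hy (Rmin_l _ _)).
    assert (H2 := Rlt_le_trans _ _ _ Hy (Rmin_r _ _)). apply Rabs_def2 in H2.
    assert (Hn := pos_INR n). assert (Hy1 : y - 1 <> 0) by lra.
    specialize (H y (conj Hy0 H1)). cbv beta in H.
    replace (sum_n (fun b => c b * (hurwitz_num (INR b) (INR (S m)) (S n) y / (y - 1))) m)
      with (sum_n (fun b => c b * hurwitz_num (INR b) (INR (S m)) (S n) y) m * / (y - 1)).
    + apply Rmult_eq_reg_l with (y - 1); [|exact Hy1].
      rewrite Rmult_0_r, <- H. field. exact Hy1.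
    + rewrite <- (sum_n_mult_r (K := R_Ring)). apply sum_n_ext. intros b.
      unfold mult; simpl. unfold Rdiv. ring.
  - apply (is_derive_sum (fun b s => c b * (hurwitz_num (INR b) (INR (S m)) (S n) s / (s - 1)))).
    intros b. apply (is_derive_scal (fun s => hurwitz_num (INR b) (INR (S m)) (S n) s / (s - 1))).
    apply is_derive_hurwitz_num; [apply pos_INR|].
    rewrite S_INR. assert (H := pos_INR m). lra.
Qed.

(** * From complex to real power series *)

Lemma ball_RtoC (x y : R) (e : posreal) : Rabs (y - x) < e -> ball (RtoC x) e (RtoC y).
Proof.
  intros H. split; [exact H|].
  unfold ball; simpl; unfold AbsRing_ball, abs, minus, plus, opp; simpl.
  rewrite Ropp_0, Rplus_0_l, Rabs_R0. apply cond_pos.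
Qed.

Lemma pow_n_RtoC (d : R) (k : nat) : pow_n (K := C_Ring) (RtoC d) k = RtoC (d ^ k).
Proof.
  induction k as [|k IH]; [reflexivity|]. simpl. rewrite IH. symmetry. apply RtoC_mult.
Qed.

Lemma Cpow_RtoC (d : R) (k : nat) : Cpow (RtoC d) k = RtoC (d ^ k).
Proof. induction k as [|k IH]; [reflexivity|]. simpl. rewrite IH. symmetry. apply RtoC_mult. Qed.

Lemma is_series_components (a : nat -> C) (l : C) :
  is_series (K := C_AbsRing) (V := C_NormedModule) a l ->
  is_series (fun k => Re (a k)) (Re l) /\ is_series (fun k => Im (a k)) (Im l).
Proof.
  intros H.
  assert (E : forall N, Re (sum_n a N) = sum_n (fun k => Re (a k)) N /\
    Im (sum_n a N) = sum_n (fun k => Im (a k)) N).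
  { induction N as [|N [IH1 IH2]]; [now rewrite !sum_O|].
    rewrite !sum_Sn, <- IH1, <- IH2. split; reflexivity. }
  split; intros P [e HP];
    destruct (H (fun w => ball l e w) (locally_ball l e)) as [N HN];
    exists N; intros k Hk; specialize (HN k Hk);
    [change (P (sum_n (fun k => Re (a k)) k)); rewrite <- (proj1 (E k))
    |change (P (sum_n (fun k => Im (a k)) k)); rewrite <- (proj2 (E k))]; apply HP, HN.
Qed.

(** At a real argument the powers are real, so real and imaginary parts pass to the coefficients. *)
Lemma is_pseries_components (a : nat -> C) (d : R) (l : C) :
  is_pseries (K := C_AbsRing) (V := C_NormedModule) a (RtoC d) l ->
  is_pseries (fun k => Re (a k)) d (Re l) /\ is_pseries (fun k => Im (a k)) d (Im l).
Proof.
  intros H. apply is_series_components in H. destruct H as [H1 H2].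
  split; apply is_pseries_R; [apply is_series_ext with (2 := H1)|apply is_series_ext with (2 := H2)];
    intros k; unfold scal; simpl; unfold mult; simpl; rewrite pow_n_RtoC; simpl; unfold Re, Im; ring.
Qed.

Lemma locally_RtoC (x : R) (P : C -> Prop) :
  locally (RtoC x) P -> locally x (fun y => P (RtoC y)).
Proof. intros [e H]. exists e. intros y Hy. apply H, ball_RtoC, Hy. Qed.

Lemma analytic_at_components (f : C -> C) (a : nat -> C) (x : R) :
  locally (RtoC x) (fun w => is_pseries (K := C_AbsRing) (V := C_NormedModule) a (w - RtoC x)%C (f w)) ->
  locally x (fun y => is_pseries (fun k => Re (a k)) (y - x) (Re (f (RtoC y)))) /\
  locally x (fun y => is_pseries (fun k => Im (a k)) (y - x) (Im (f (RtoC y)))).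
Proof.
  intros H. apply locally_RtoC in H.
  split; apply filter_imp with (2 := H); intros y Hy; rewrite <- RtoC_minus in Hy;
    apply is_pseries_components in Hy; tauto.
Qed.

Lemma laurent_components (f : C -> C) (k : nat) (a : nat -> C) (x : R) :
  locally' (RtoC x) (fun w => is_pseries (K := C_AbsRing) (V := C_NormedModule) a (w - RtoC x)%C
    (Cpow (w - RtoC x) k * f w)%C) ->
  punctured_pseries (fun k => Re (a k)) (fun y => (y - x) ^ k * Re (f (RtoC y))) x /\
  punctured_pseries (fun k => Im (a k)) (fun y => (y - x) ^ k * Im (f (RtoC y))) x.
Proof.
  intros H. apply locally_RtoC in H.
  destruct (locally_Rabs_elim _ _ H) as (e & He & H').
  assert (H2 : forall y, 0 < Rabs (y - x) < e ->
    is_pseries (fun k => Re (a k)) (y - x) ((y - x) ^ k * Re (f (RtoC y))) /\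
    is_pseries (fun k => Im (a k)) (y - x) ((y - x) ^ k * Im (f (RtoC y)))).
  { intros y [Hy0 Hy].
    assert (Hyx : RtoC y <> RtoC x).
    { intros E. apply RtoC_inj in E. rewrite E, Rminus_diag, Rabs_R0 in Hy0. lra. }
    specialize (H' y Hy Hyx). rewrite <- RtoC_minus, Cpow_RtoC in H'.
    apply is_pseries_components in H'. destruct H' as [H1 H2].
    split.
    - replace ((y - x) ^ k * Re (f (RtoC y))) with (Re (RtoC ((y - x) ^ k) * f (RtoC y))%C); [exact H1|].
      unfold Re; simpl. ring.
    - replace ((y - x) ^ k * Im (f (RtoC y))) with (Im (RtoC ((y - x) ^ k) * f (RtoC y))%C); [exact H2|].
      unfold Im; simpl. ring. }
  split; exists e; (split; [exact He|]); intros y Hy; apply (H2 y Hy).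
Qed.

Lemma laurent_real_components (L : C -> C) :
  (forall s : C, analytic_at L s \/ pole_at L s) ->
  forall x, laurent_real (fun y => Re (L (RtoC y))) x /\ laurent_real (fun y => Im (L (RtoC y))) x.
Proof.
  intros H x. destruct (H (RtoC x)) as [[a Ha]|(k & a & _ & Ha)].
  - apply analytic_at_components in Ha. destruct Ha as [H1 H2].
    split; [exists 0%nat, (fun k => Re (a k))|exists 0%nat, (fun k => Im (a k))];
      [destruct (locally_Rabs_elim _ _ H1) as (e & He & H')|destruct (locally_Rabs_elim _ _ H2) as (e & He & H')];
      exists e; (split; [exact He|]); intros y Hy; rewrite pow_O, Rmult_1_l; apply H', Hy.
  - apply laurent_components in Ha.
    split; [exists (S k), (fun k => Re (a k))|exists (S k), (fun k => Im (a k))]; tauto.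
Qed.

(** Off [x] the series equals [(y - x) ^ S k * V y], which tends to 0 as [V] is continuous, while
    its limit is [a 0]. *)
Lemma pole_coef_zero (u V : R -> R) (k : nat) (a : nat -> R) (x : R) :
  punctured_pseries a (fun y => (y - x) ^ S k * u y) x ->
  punctured_zero (fun y => u y - V y) x -> continuous V x -> a 0%nat = 0.
Proof.
  intros Ha (e & He & Hz) HV.
  destruct (punctured_elim _ _ _ Ha) as (d & Hd & HR & H).
  replace (a 0%nat) with (PSeries a (x - x)) by (rewrite Rminus_diag; apply PSeries_0).
  replace 0 with ((x - x) ^ S k * V x) by (simpl; ring).
  apply (cont_punctured_eq (fun y => PSeries a (y - x)) (fun y => (y - x) ^ S k * V y)).
  - apply continuous_comp with (f := fun y => y - x) (g := PSeries a).
    + apply (ex_derive_continuous (V := R_NormedModule)). auto_derive. exact I.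
    + rewrite Rminus_diag. apply continuity_pt_filterlim, PSeries_continuity.
      apply lt_radius with d; [rewrite Rabs_R0; lra|exact HR].
  - apply (continuous_mult (K := R_AbsRing) (fun y => (y - x) ^ S k) V); [|exact HV].
    apply (ex_derive_continuous (V := R_NormedModule)). auto_derive. exact I.
  - exists (Rmin e d). split; [now apply Rmin_glb_lt|].
    intros y [Hy0 Hy]. assert (H1 := Rlt_le_trans _ _ _ Hy (Rmin_l _ _)).
    assert (H2 := Rlt_le_trans _ _ _ Hy (Rmin_r _ _)).
    rewrite (is_pseries_unique _ _ _ (H y (conj Hy0 H2))).
    rewrite <- Rmult_minus_distr_l, (Hz y (conj Hy0 H1)). ring.
Qed.

(** Both functions are continuous at [x], so agreement around [x] extends to [x] itself, and the
    derivatives coincide. *)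
Lemma pseries_coef_1 (u V : R -> R) (a : nat -> R) (x l : R) :
  locally x (fun y => is_pseries a (y - x) (u y)) ->
  punctured_zero (fun y => u y - V y) x -> is_derive V x l -> a 1%nat = l.
Proof.
  intros Ha Hz HV.
  assert (Hu := analytic_derive u x a Ha).
  assert (Ex : u x = V x).
  { apply cont_punctured_eq; auto.
    - apply (ex_derive_continuous (V := R_NormedModule)). now exists (a 1%nat).
    - apply (ex_derive_continuous (V := R_NormedModule)). now exists l. }
  assert (Hu' : is_derive V x (a 1%nat)).
  { apply is_derive_ext_loc with u; [|exact Hu].
    destruct Hz as (e & He & Hz). apply locally_Rabs with e; [exact He|].
    intros y Hy. destruct (Req_dec y x) as [->|Hne]; [exact Ex|].
    apply Rminus_diag_uniq, Hz. split; [apply Rabs_pos_lt; lra|exact Hy]. }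
  apply is_derive_unique in Hu'. apply is_derive_unique in HV. congruence.
Qed.

(** * Complex differentiability of power series *)

Lemma Cmod_sum_n_le (a : nat -> C) (b : nat -> R) (N : nat) :
  (forall k, Cmod (a k) <= b k) -> Cmod (sum_n a N) <= sum_n b N.
Proof.
  intros H. induction N as [|N IH]; [rewrite !sum_O; apply H|].
  rewrite !sum_Sn. eapply Rle_trans; [apply Cmod_triangle|].
  unfold plus; simpl. apply Rplus_le_compat; auto.
Qed.

Lemma Cmod_is_series_le (a : nat -> C) (l : C) (B : R) :
  is_series (K := C_AbsRing) (V := C_NormedModule) a l ->
  (forall N, Cmod (sum_n a N) <= B) -> Cmod l <= B.
Proof.
  intros H HB.
  assert (H1 := filterlim_comp _ _ _ _ _ _ _ _ H (filterlim_norm (K := C_AbsRing) (V := C_NormedModule) l)).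
  apply (is_lim_seq_le (fun N => Cmod (sum_n a N)) (fun _ => B) (Cmod l) B); auto.
  apply is_lim_seq_const.
Qed.

Lemma geometric_half_le (N : nat) : sum_n (fun k => (1 / 2) ^ k) N <= 2.
Proof.
  assert (H : sum_n (fun k => (1 / 2) ^ k) N = 2 - (1 / 2) ^ N).
  { induction N as [|N IH]; [rewrite sum_O; simpl; lra|].
    rewrite sum_Sn, IH. unfold plus; simpl. field. }
  rewrite H. assert (0 < (1 / 2) ^ N) by (apply pow_lt; lra). lra.
Qed.

(** Removing two coefficients and dividing by [(w - z) ^ 2] leaves a series bounded near [z], so the
    first-order error is quadratic in [w - z]. *)
Lemma is_derive_C_pseries (f : C -> C) (a : nat -> C) (z : C) :
  locally z (fun w => is_pseries (K := C_AbsRing) (V := C_NormedModule) a (w - z)%C (f w)) ->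
  is_derive (K := C_AbsRing) (V := C_NormedModule) f z (a 1%nat).
Proof.
  intros [e H].
  assert (He := cond_pos e).
  set (r := e / 2).
  assert (Hr : 0 < r) by (unfold r; lra).
  assert (Hz : f z = a 0%nat).
  { assert (H0 := H z (ball_center z e)).
    replace (z - z)%C with (RtoC 0) in H0 by ring.
    assert (H1 := is_pseries_0 (K := C_AbsRing) (V := C_NormedModule) a).
    apply (filterlim_locally_unique (V := C_NormedModule) _ _ _ H0 H1). }
  assert (HB : exists B, 0 <= B /\ forall k, Cmod (a k) * r ^ k <= B).
  (* Convergence at one point with a real displacement suffices to bound the coefficients, and there
     the terms split into real and imaginary parts. *)
  { assert (Hb : ball z e (z + RtoC r)%C).
    { split; unfold ball; simpl; unfold AbsRing_ball, abs, minus, plus, opp; simpl.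
      - replace (fst z + r + - fst z) with r by ring. rewrite Rabs_pos_eq; unfold r; lra.
      - replace (snd z + 0 + - snd z) with 0 by ring. rewrite Rabs_R0; lra. }
    assert (H1 := H _ Hb). replace (z + RtoC r - z)%C with (RtoC r) in H1 by ring.
    apply is_pseries_components in H1. destruct H1 as [H1 H2].
    destruct (pseries_bounded _ _ _ H1) as [B1 HB1].
    destruct (pseries_bounded _ _ _ H2) as [B2 HB2].
    assert (P1 := Rle_trans _ _ _ (Rabs_pos _) (HB1 0%nat)).
    assert (P2 := Rle_trans _ _ _ (Rabs_pos _) (HB2 0%nat)).
    (* The modulus is at most [sqrt 2] times the larger component, which [B1 + B2] bounds after
       scaling by [r ^ k]. *)
    exists (sqrt 2 * (B1 + B2)). assert (Hs := sqrt_pos 2).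
    split; [nra|]. intros k.
    specialize (HB1 k). specialize (HB2 k).
    assert (Hk : 0 < r ^ k) by (apply pow_lt, Hr).
    rewrite Rabs_mult, (Rabs_pos_eq (r ^ k)) in HB1, HB2 by lra.
    assert (HC := Cmod_2Rmax (a k)).
    assert (Rmax (Rabs (fst (a k))) (Rabs (snd (a k))) * r ^ k <= B1 + B2).
    { unfold Rmax, Re, Im in *. destruct Rle_dec; lra. }
    nra. }
  destruct HB as (B & HB0 & HB).
  (* For [Cmod (w - z) <= r / 2] the twice shifted series has [k]th term at most
     [B / r ^ 2 * (1 / 2) ^ k]; the geometric sum gives the factor 2. *)
  set (K := 2 * (B / r ^ 2)).
  assert (HK : 0 <= K).
  { unfold K. assert (0 < / r ^ 2) by (apply Rinv_0_lt_compat, pow_lt, Hr). unfold Rdiv; nra. }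
  assert (Hq : forall w : C, ball z e w -> Cmod (w - z) <= r / 2 ->
    Cmod (f w - f z - (w - z) * a 1%nat) <= K * Cmod (w - z) ^ 2).
  { intros w Hw Hd. rewrite Hz.
    destruct (Ceq_dec (w - z) 0) as [E|E].
    { assert (Ew : w = z) by (replace w with ((w - z) + z)%C by ring; rewrite E; ring).
      rewrite E, Ew, Hz. replace (a 0%nat - a 0%nat - 0 * a 1%nat)%C with (RtoC 0) by ring.
      rewrite Cmod_0. nra. }
    assert (H1 := is_pseries_decr_1 (K := C_AbsRing) (V := C_NormedModule) _ _ _ _ (Cinv_l _ E) (H w Hw)).
    assert (H2 := is_pseries_decr_1 (K := C_AbsRing) (V := C_NormedModule) _ _ _ _ (Cinv_l _ E) H1).
    match type of H2 with is_pseries ?b ?d ?l => set (q := l) in H2 end.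
    assert (Eq : (f w - a 0%nat - (w - z) * a 1%nat = (w - z) * (w - z) * q)%C).
    { unfold q. unfold scal, plus, opp, PS_decr_1; simpl. unfold mult; simpl.
      match goal with |- @eq _ ?x ?y => change (@eq C x y) end. field. exact E. }
    rewrite Eq, !Cmod_mult.
    assert (Hqb : Cmod q <= K).
    { apply (Cmod_is_series_le _ _ _ H2). intros N.
      apply Rle_trans with (sum_n (fun k => B / r ^ 2 * (1 / 2) ^ k) N).
      - apply Cmod_sum_n_le. intros k.
        change (Cmod (pow_n (K := C_Ring) (w - z)%C k * a (S (S k)))%C <= B / r ^ 2 * (1 / 2) ^ k).
        rewrite Cmod_mult.
        assert (Ep : Cmod (pow_n (K := C_Ring) (w - z)%C k) = Cmod (w - z) ^ k).
        { clear. induction k as [|k IH]; simpl; [apply Cmod_1|].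
          unfold mult; simpl. now rewrite Cmod_mult, IH. }
        rewrite Ep.
        assert (Hk : 0 < r ^ S (S k)) by (apply pow_lt, Hr).
        assert (Hd' : Cmod (w - z) ^ k <= (r / 2) ^ k).
        { apply pow_incr. split; [apply Cmod_ge_0|exact Hd]. }
        specialize (HB (S (S k))).
        apply Rle_trans with ((r / 2) ^ k * Cmod (a (S (S k)))).
        + apply Rmult_le_compat_r; [apply Cmod_ge_0|exact Hd'].
        + apply Rmult_le_reg_r with (r ^ 2); [apply pow_lt, Hr|].
          replace (B / r ^ 2 * (1 / 2) ^ k * r ^ 2) with (B * (1 / 2) ^ k) by (field; lra).
          replace (r / 2) with (r * (1 / 2)) by field. rewrite Rpow_mult_distr.
          replace (r ^ k * (1 / 2) ^ k * Cmod (a (S (S k))) * r ^ 2)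
            with (Cmod (a (S (S k))) * r ^ S (S k) * (1 / 2) ^ k) by (simpl; ring).
          apply Rmult_le_compat_r; [apply pow_le; lra|exact HB].
      - replace (sum_n (fun k => B / r ^ 2 * (1 / 2) ^ k) N) with (B / r ^ 2 * sum_n (fun k => (1 / 2) ^ k) N)
          by (symmetry; apply (sum_n_mult_l (K := R_Ring))).
        unfold K. rewrite Rmult_comm. apply Rmult_le_compat_r; [|apply geometric_half_le].
        unfold K in HK. lra. }
    assert (Hc := Cmod_ge_0 (w - z)). simpl. nra. }
  split; [apply is_linear_scal_l|].
  intros x Hx.
  apply (is_filter_lim_locally_unique (K := C_AbsRing) (V := AbsRing_NormedModule C_AbsRing)) in Hx.
  subst x. intros eps.
  (* [K + 1] guards against [K = 0]. *)
  assert (Hm : 0 < Rmin (r / 2) (eps / (K + 1))).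
  { apply Rmin_glb_lt; [lra|]. apply Rdiv_lt_0_compat; [apply cond_pos|lra]. }
  apply filter_imp with (fun w : C => ball (M := C_UniformSpace) z e w /\ Cmod (w - z) < Rmin (r / 2) (eps / (K + 1))).
  - intros w [Hw Hd].
    assert (H1 := Rlt_le_trans _ _ _ Hd (Rmin_l _ _)).
    assert (H2 := Rlt_le_trans _ _ _ Hd (Rmin_r _ _)).
    apply Rle_trans with (K * Cmod (w - z) ^ 2); [exact (Hq w Hw (Rlt_le _ _ H1))|].
    change (norm (minus w z)) with (Cmod (w - z)).
    assert (Hc := Cmod_ge_0 (w - z)).
    assert (Cmod (w - z) * (K + 1) <= eps).
    { apply Rmult_le_reg_r with (/ (K + 1)); [apply Rinv_0_lt_compat; lra|].
      rewrite Rmult_assoc, Rinv_r, Rmult_1_r by lra. unfold Rdiv in H2. lra. }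
    simpl. nra.
  - apply filter_and.
    + exists e. intros w Hw. apply (norm_compat1 (V := C_NormedModule) z w e), Hw.
    + exists (mkposreal _ Hm). intros w Hw. exact Hw.
Qed.

(** * Membership in the field generated by t and exp(-t) *)

(* Equivalent to being rational: every subfield of [C] contains the rationals,
   and these form one. *)
Definition rat (x : R) : Prop := forall K : C -> Prop, subfield K -> K (RtoC x).

Lemma rat_1 : rat 1.
Proof. intros K HK. apply (sf_one K HK). Qed.

Lemma rat_minus (x y : R) : rat x -> rat y -> rat (x - y).
Proof. intros Hx Hy K HK. rewrite RtoC_minus. apply (sf_sub K HK); [apply Hx|apply Hy]; exact HK. Qed.

Lemma rat_mult (x y : R) : rat x -> rat y -> rat (x * y).
Proof. intros Hx Hy K HK. rewrite RtoC_mult. apply (sf_mul K HK); [apply Hx|apply Hy]; exact HK. Qed.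

Lemma rat_inv (x : R) : x <> 0 -> rat x -> rat (/ x).
Proof.
  intros H0 Hx K HK. rewrite RtoC_inv by exact H0.
  apply (sf_inv K HK); [apply Hx, HK|]. intros E. apply H0, RtoC_inj, E.
Qed.

Lemma rat_0 : rat 0.
Proof. rewrite <- (Rminus_diag 1). apply rat_minus; apply rat_1. Qed.

Lemma rat_opp (x : R) : rat x -> rat (- x).
Proof. intros Hx. rewrite <- Rminus_0_l. apply rat_minus; [apply rat_0|exact Hx]. Qed.

Lemma rat_plus (x y : R) : rat x -> rat y -> rat (x + y).
Proof.
  intros Hx Hy. replace (x + y) with (x - - y) by ring.
  apply rat_minus; [exact Hx|now apply rat_opp].
Qed.

Lemma rat_div (x y : R) : y <> 0 -> rat x -> rat y -> rat (x / y).
Proof. intros H0 Hx Hy. apply rat_mult; [exact Hx|now apply rat_inv]. Qed.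

Lemma rat_INR (k : nat) : rat (INR k).
Proof.
  induction k as [|k IH]; [apply rat_0|]. rewrite S_INR. apply rat_plus; [exact IH|apply rat_1].
Qed.

Lemma rat_pow (x : R) (k : nat) : rat x -> rat (x ^ k).
Proof. intros Hx. induction k as [|k IH]; [apply rat_1|]. simpl. now apply rat_mult. Qed.

Lemma rat_sum (f : nat -> R) (N : nat) : (forall i, rat (f i)) -> rat (sum_n f N).
Proof.
  intros H. induction N as [|N IH]; [rewrite sum_O; apply H|].
  rewrite sum_Sn. apply (rat_plus _ _ IH (H (S N))).
Qed.

Lemma rat_rem_coef (b m : R) (N : nat) : m <> 0 -> rat b -> rat m -> forall k, rat (rem_coef b m N k).
Proof.
  intros H0 Hb Hm.
  assert (HF : forall k, INR (fact k) <> 0) by (intros k; apply Rgt_not_eq, INR_fact_pos).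
  induction N as [|N IH]; intros k; simpl rem_coef.
  - apply rat_div; [apply HF|now apply rat_pow, rat_opp|apply rat_INR].
  - apply rat_minus; [apply IH|]. apply rat_mult; [apply rat_div; auto|].
    apply rat_opp, rat_div; [apply HF|now apply rat_pow, rat_opp|apply rat_INR].
Qed.

Lemma rat_taylor_coef (b m : R) (N : nat) : m <> 0 -> rat b -> rat m -> rat (taylor_coef b m N).
Proof. intros H0 Hb Hm. apply rat_div; auto. now apply rat_rem_coef. Qed.

Lemma rat_rise (j : nat) (z : R) : rat z -> rat (rise j z).
Proof.
  intros Hz. induction j as [|j IH]; simpl; [apply rat_1|].
  apply rat_mult; [exact IH|]. apply rat_plus; [exact Hz|apply rat_INR].
Qed.

Lemma rat_drise (j : nat) (z : R) : rat z -> rat (drise j z).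
Proof.
  intros Hz. induction j as [|j IH]; simpl; [apply rat_0|].
  apply rat_plus; [|now apply rat_rise].
  apply rat_mult; [exact IH|]. apply rat_plus; [exact Hz|apply rat_INR].
Qed.

Lemma rat_rational_part (b m w : R) (p : nat) :
  m <> 0 -> w <> 0 -> rat b -> rat m -> rat w -> rat (rational_part b m p w).
Proof.
  intros H0 Hw0 Hb Hm Hw. apply rat_div; [now apply pow_nonzero| |now apply rat_pow].
  apply rat_minus; [apply rat_mult; [|exact Hw]|]; apply rat_sum; intros j; apply rat_mult;
    auto using rat_taylor_coef, rat_rise, rat_drise.
Qed.

Local Open Scope C_scope.

(** Natural parameters allow [exp (- (b * w))] to be written as a power of [Cexp (- w)], so that the
    function is visibly rational in [w] and [Cexp (- w)]. *)
Fixpoint taylor_rem_C (b M : nat) (N : nat) (w : C) : C :=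
  match N with
  | O => w * Cpow (Cexp (- w)) b * / (1 - Cpow (Cexp (- w)) M)
  | S N => (taylor_rem_C b M N w - RtoC (taylor_coef (INR b) (INR M) N)) * / w
  end.

Lemma Cexp_RtoC (x : R) : Cexp (RtoC x) = RtoC (exp x).
Proof.
  unfold Cexp, RtoC; simpl. rewrite cos_0, sin_0. f_equal; ring.
Qed.

Lemma exp_pow_nat (t : R) (k : nat) : (exp (- t) ^ k = exp (- (INR k * t)))%R.
Proof.
  induction k as [|k IH].
  - simpl. now rewrite Rmult_0_l, Ropp_0, exp_0.
  - rewrite S_INR. replace (- ((INR k + 1) * t))%R with (- t + - (INR k * t))%R by ring.
    rewrite exp_plus, <- IH. reflexivity.
Qed.

Lemma Cpow_Cexp (t : R) (k : nat) :
  Cpow (Cexp (- RtoC t)) k = RtoC (exp (- (INR k * t))).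
Proof. now rewrite <- RtoC_opp, Cexp_RtoC, Cpow_RtoC, exp_pow_nat. Qed.

Lemma taylor_rem_C_RtoC (b M N : nat) (t : R) :
  (0 < M)%nat -> (0 < t)%R ->
  taylor_rem_C b M N (RtoC t) = RtoC (taylor_rem (INR b) (INR M) N t).
Proof.
  intros HM Ht. apply lt_0_INR in HM. induction N as [|N IH]; cbn [taylor_rem_C taylor_rem].
  - assert (exp (- (INR M * t)) < 1)%R by (apply exp_lt_1; nra).
    rewrite !Cpow_Cexp, <- RtoC_minus, <- RtoC_inv, <- !RtoC_mult by lra. reflexivity.
  - rewrite IH, <- RtoC_minus, <- RtoC_inv, <- RtoC_mult by lra. reflexivity.
Qed.

Lemma mero_eq_of_eq (f g : C -> C) : (forall w, f w = g w) -> mero_eq f g.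
Proof. intros H z. exists (mkposreal 1 Rlt_0_1). intros w _ _. apply H. Qed.

(** Positive reals accumulate at 0, so [f] cannot vanish on a punctured neighbourhood of 0. This
    justifies every inversion in the field by a check on the positive axis. *)
Lemma not_mero_eq_0 (f : C -> C) :
  (forall t, (0 < t)%R -> f (RtoC t) <> 0) -> ~ mero_eq f (fun _ => 0).
Proof.
  intros H E. destruct (E 0) as [e He]. assert (Hp := cond_pos e).
  apply (H (e / 2)%R ltac:(lra)). apply He.
  - apply ball_RtoC. rewrite Rminus_0_r, Rabs_pos_eq; lra.
  - intros E2. apply RtoC_inj in E2. lra.
Qed.

(** Stands in for function extensionality when a member of [F] is rewritten pointwise. *)
Lemma msf_ext (F : (C -> C) -> Prop) (HF : mero_subfield F)
    (f g : C -> C) : F f -> (forall w, f w = g w) -> F g.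
Proof. intros Hf H. apply (msf_eq F HF f g Hf), mero_eq_of_eq, H. Qed.

Lemma msf_add (F : (C -> C) -> Prop) (HF : mero_subfield F)
    (f g : C -> C) : F f -> F g -> F (fun w => f w + g w).
Proof.
  intros Hf Hg.
  assert (H1 := msf_one F HF).
  assert (H2 := msf_sub F HF _ _ (msf_sub F HF _ _ H1 H1) Hg).
  apply (msf_ext F HF) with (1 := msf_sub F HF _ _ Hf H2). intros w. ring.
Qed.

Lemma msf_pow (F : (C -> C) -> Prop) (HF : mero_subfield F)
    (f : C -> C) (k : nat) : F f -> F (fun w => Cpow (f w) k).
Proof.
  intros Hf. induction k as [|k IH]; [apply (msf_one F HF)|].
  apply (msf_mul F HF _ _ Hf IH).
Qed.

Lemma msf_sum (F : (C -> C) -> Prop) (HF : mero_subfield F)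
    (f : nat -> C -> C) (N : nat) :
  (forall i, F (f i)) -> F (fun w => sum_n (fun i => f i w) N).
Proof.
  intros H. induction N as [|N IH].
  - apply (msf_ext F HF) with (1 := H 0%nat). intros w. now rewrite sum_O.
  - apply (msf_ext F HF) with (1 := (msf_add F HF) _ _ IH (H (S N))). intros w. now rewrite sum_Sn.
Qed.

Lemma msf_taylor_rem_C (F : (C -> C) -> Prop) (HF : mero_subfield F)
    (b M N : nat) :
  (0 < M)%nat -> (forall x, rat x -> F (fun _ => RtoC x)) ->
  F (fun w => w) -> F (fun w => Cexp (- w)) -> F (taylor_rem_C b M N).
Proof.
  intros HM Hc Ht He. assert (HM' := lt_0_INR _ HM).
  induction N as [|N IH].
  - apply (msf_mul F HF).
    + apply (msf_mul F HF); [exact Ht|apply (msf_pow F HF), He].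
    + apply (msf_inv F HF).
      * apply (msf_sub F HF); [apply (msf_one F HF)|apply (msf_pow F HF), He].
      * apply not_mero_eq_0. intros t Htp. rewrite Cpow_Cexp, <- RtoC_minus.
        assert (exp (- (INR M * t)) < 1)%R by (apply exp_lt_1; nra).
        intros E. apply RtoC_inj in E. lra.
  - apply (msf_mul F HF (fun w => taylor_rem_C b M N w - RtoC (taylor_coef (INR b) (INR M) N))).
    + apply (msf_sub F HF _ _ IH). apply Hc, rat_taylor_coef; try apply rat_INR. lra.
    + apply (msf_inv F HF _ Ht). apply not_mero_eq_0. intros t Htp E. apply RtoC_inj in E. lra.
Qed.

(** * The integrand and its integral *)

Definition period_summand (b M n : nat) (w : C) : C :=
  RtoC (rise (S n) (- INR (S n)) / - INR (S n)) * (Cexp (- w) * taylor_rem_C b M (S (S n)) w) +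
  RtoC (rational_part (INR b) (INR M) (S n) (- INR (S n))) * Cexp (- w).

Definition period_summand_real (b M n : nat) (t : R) : R :=
  (rise (S n) (- INR (S n)) / - INR (S n) * mellin_rem (INR b) (INR M) (S n) t +
   rational_part (INR b) (INR M) (S n) (- INR (S n)) * exp (- t))%R.

Lemma period_summand_RtoC (b M n : nat) (t : R) :
  (0 < M)%nat -> (0 < t)%R ->
  period_summand b M n (RtoC t) = RtoC (period_summand_real b M n t).
Proof.
  intros HM Ht. unfold period_summand, period_summand_real, mellin_rem.
  rewrite taylor_rem_C_RtoC, <- RtoC_opp, Cexp_RtoC by assumption.
  now rewrite !RtoC_plus, !RtoC_mult.
Qed.

Lemma integral_period_summand (b M n : nat) :
  (0 < M)%nat ->
  integral0oo (period_summand_real b M n) (hurwitz_deriv (INR b) (INR M) n).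
Proof.
  intros HM.
  assert (HM' : (1 <= INR M)%R) by (apply (le_INR 1), HM).
  apply integral0oo_plus.
  - apply integral0oo_scal.
    apply integral0oo_ext with (2 := is_mellin _ 1 (expo_bounded_mellin_rem (INR b) (INR M) (S n) (pos_INR b) HM') Rlt_0_1).
    intros t Ht. rewrite Rminus_diag, Rpower_O by exact Ht. apply Rmult_1_l.
  - assert (I := integral0oo_scal (rational_part (INR b) (INR M) (S n) (- INR (S n))) _ _ (is_gam 1 Rlt_0_1)).
    rewrite gam_1, Rmult_1_r in I. apply integral0oo_ext with (2 := I).
    intros t Ht. cbv beta. now rewrite Rminus_diag, Rpower_O, Rmult_1_l by exact Ht.
Qed.

Lemma is_RInt_gen_pair (f : R -> C) (l : C) :
  integral0oo (fun t => Re (f t)) (Re l) -> integral0oo (fun t => Im (f t)) (Im l) ->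
  is_RInt_gen (V := C_R_NormedModule) f (at_right 0) (Rbar_locally p_infty) l.
Proof.
  intros H1 H2 P [e HP].
  assert (K1 := H1 (fun y => ball (Re l) e y) (locally_ball (Re l) e)).
  assert (K2 := H2 (fun y => ball (Im l) e y) (locally_ball (Im l) e)).
  unfold filtermapi in *.
  apply filter_imp with (2 := filter_and _ _ K1 K2).
  intros [a b] [(y1 & I1 & B1) (y2 & I2 & B2)].
  exists (y1, y2). split.
  - apply (is_RInt_fct_extend_pair (U := R_NormedModule) (V := R_NormedModule) f a b y1 y2 I1 I2).
  - apply HP. split; [exact B1|exact B2].
Qed.

Lemma Re_Im_sum_n_RtoC (c : nat -> C) (g : nat -> R) (N : nat) :
  Re (sum_n (fun b => c b * RtoC (g b)) N) = sum_n (fun b => Re (c b) * g b)%R N /\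
  Im (sum_n (fun b => c b * RtoC (g b)) N) = sum_n (fun b => Im (c b) * g b)%R N.
Proof.
  assert (E1 : forall x y, Re (x * RtoC y) = (Re x * y)%R) by (intros; unfold Re; simpl; ring).
  assert (E2 : forall x y, Im (x * RtoC y) = (Im x * y)%R) by (intros; unfold Im; simpl; ring).
  induction N as [|N [IH1 IH2]]; [rewrite !sum_O; auto|].
  rewrite !sum_Sn, <- IH1, <- IH2, <- E1, <- E2. split; reflexivity.
Qed.

Lemma integral_complex_combination (c : nat -> C) (g : nat -> R -> R) (l : nat -> R) (f : C -> C) (N : nat) :
  (forall b, integral0oo (g b) (l b)) ->
  (forall t, (0 < t)%R -> f (RtoC t) = sum_n (fun b => c b * RtoC (g b t)) N) ->
  is_RInt_gen (V := C_R_NormedModule) (fun t : R => f (RtoC t)) (at_right 0) (Rbar_locally p_infty)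
    (sum_n (fun b => c b * RtoC (l b)) N).
Proof.
  intros Hg Hf.
  apply is_RInt_gen_pair.
  - rewrite (proj1 (Re_Im_sum_n_RtoC c l N)).
    apply integral0oo_ext with (fun t => sum_n (fun b => Re (c b) * g b t)%R N).
    + intros t Ht. rewrite (Hf t Ht). symmetry. apply (Re_Im_sum_n_RtoC c (fun b => g b t)).
    + apply (integral0oo_sum (fun b t => Re (c b) * g b t)%R). intros b _. apply integral0oo_scal, Hg.
  - rewrite (proj2 (Re_Im_sum_n_RtoC c l N)).
    apply integral0oo_ext with (fun t => sum_n (fun b => Im (c b) * g b t)%R N).
    + intros t Ht. rewrite (Hf t Ht). symmetry. apply (Re_Im_sum_n_RtoC c (fun b => g b t)).
    + apply (integral0oo_sum (fun b t => Im (c b) * g b t)%R). intros b _. apply integral0oo_scal, Hg.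
Qed.

Lemma nat_Cpower_RtoC (k : nat) (s : R) :
  nat_Cpower k (- RtoC s) = RtoC (Rpower (INR k) (- s)).
Proof. unfold nat_Cpower. now rewrite <- RtoC_opp, <- RtoC_mult, Cexp_RtoC. Qed.

Lemma periodic_nat (chi : Z -> C) (m : nat) :
  (forall a : Z, chi (a + Z.of_nat (S m))%Z = chi a) ->
  forall i b : nat, chi (Z.of_nat (S (i * S m + b))) = chi (Z.of_nat (S b)).
Proof.
  intros H i b. induction i as [|i IH]; [reflexivity|].
  rewrite <- IH, <- (H (Z.of_nat (S (i * S m + b)))). f_equal. lia.
Qed.

Theorem corollary1p21 (m : Z) (hm : (0 < m)%Z) (chi : Z -> C)
    (hchi : dirichlet_character m chi)
    (L : C -> C) (hL : dirichlet_L chi L) (n : nat) :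
  exists l : C,
    is_derive L (RtoC (- INR n)) l /\
    exponential_period (field_t_exp (Q_adjoin_values chi)) l.
Proof.
  set (m' := (Z.to_nat m - 1)%nat).
  assert (Em : m = Z.of_nat (S m')) by (unfold m'; lia).
  clearbody m'. subst m.
  (* Shifted by one so that the Dirichlet series starts at index 0; the residues [1] to [m] become
     [0] to [m']. *)
  set (c := fun k => chi (Z.of_nat (S k))).
  assert (Hc := periodic_nat chi m' (dc_periodic _ _ hchi)).
  assert (HS : forall s, (1 < s)%R ->
    is_series (fun j => Re (c j) * Rpower (INR (S j)) (- s))%R (Re (L (RtoC s))) /\
    is_series (fun j => Im (c j) * Rpower (INR (S j)) (- s))%R (Im (L (RtoC s)))).
  { intros s Hs. assert (H := dL_series _ _ hL (RtoC s) Hs).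
    apply is_series_components in H. destruct H as [H1 H2].
    split; [apply is_series_ext with (2 := H1)|apply is_series_ext with (2 := H2)];
      intros j; rewrite nat_Cpower_RtoC; unfold c, Re, Im; simpl; ring. }
  assert (HL := laurent_real_components L (dL_meromorphic _ _ hL)).
  (* The real and imaginary parts of the character are real periodic sequences, and the real-axis
     argument applies to each. *)
  destruct (continuation_near (fun k => Re (c k)) m' n _ (fun i b => f_equal Re (Hc i b))
    (fun x => proj1 (HL x)) (fun s Hs => proj1 (HS s Hs))) as (V1 & Z1 & D1).
  destruct (continuation_near (fun k => Im (c k)) m' n _ (fun i b => f_equal Im (Hc i b))
    (fun x => proj2 (HL x)) (fun s Hs => proj2 (HS s Hs))) as (V2 & Z2 & D2).
  exists (sum_n (fun b => c b * RtoC (hurwitz_deriv (INR b) (INR (S m')) n)) m').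
  split.
  - destruct (dL_meromorphic _ _ hL (RtoC (- INR n))) as [[a Ha]|(k & a & Ha0 & Ha)].
    + assert (Hcomp := analytic_at_components L a (- INR n) Ha).
      destruct Hcomp as [A1 A2].
      assert (E1 := pseries_coef_1 _ _ _ _ _ A1 Z1 D1).
      assert (E2 := pseries_coef_1 _ _ _ _ _ A2 Z2 D2).
      destruct (Re_Im_sum_n_RtoC c (fun b => hurwitz_deriv (INR b) (INR (S m')) n) m') as [S1 S2].
      (* The complex derivative is [a 1], and [E1] and [E2] identify its two components, found along
         the real axis, with those of the sum. *)
      match goal with |- is_derive _ _ ?l => replace l with (a 1%nat) end.
      * apply is_derive_C_pseries, Ha.
      * apply injective_projections; [rewrite <- S1 in E1; exact E1|rewrite <- S2 in E2; exact E2].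
    (* [V1] and [V2] are continuous at [- n], which forces both components of the leading
       coefficient to vanish. *)
    + exfalso. apply Ha0.
      assert (Hcomp := laurent_components L (S k) a (- INR n) Ha). destruct Hcomp as [A1 A2].
      assert (C1 : continuous V1 (- INR n)%R) by (apply (ex_derive_continuous (V := R_NormedModule)); eexists; exact D1).
      assert (C2 : continuous V2 (- INR n)%R) by (apply (ex_derive_continuous (V := R_NormedModule)); eexists; exact D2).
      apply injective_projections.
      * exact (pole_coef_zero _ _ _ _ _ A1 Z1 C1).
      * exact (pole_coef_zero _ _ _ _ _ A2 Z2 C2).
  - exists (fun w => sum_n (fun b => c b * period_summand b (S m') n w) m'). split.
    + intros F HF HK Ht He.
      (* Rational constants lie in every subfield of [C], in particular in those containing the
         values of the character. *)
      assert (HQ : forall x, rat x -> F (fun _ => RtoC x)).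
      { intros x Hx. apply HK. intros K HsK _. apply Hx, HsK. }
      apply (msf_sum F HF (fun b w => c b * period_summand b (S m') n w)). intros b.
      assert (Hn : (- INR (S n) <> 0)%R) by (assert (H := lt_0_INR _ (Nat.lt_0_succ n)); lra).
      assert (Hw : rat (- INR (S n))) by apply rat_opp, rat_INR.
      apply (msf_mul F HF).
      { apply HK. intros K _ HKc. apply HKc. }
      apply (msf_add F HF); apply (msf_mul F HF).
      * apply HQ, rat_div; auto. now apply rat_rise.
      * apply (msf_mul F HF); [exact He|]. apply (msf_taylor_rem_C F HF); auto. lia.
      * apply HQ, rat_rational_part; try apply rat_INR; auto.
        apply Rgt_not_eq, lt_0_INR, Nat.lt_0_succ.
      * exact He.
    + apply (integral_complex_combination c (fun b => period_summand_real b (S m') n)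
        (fun b => hurwitz_deriv (INR b) (INR (S m')) n)
        (fun w => sum_n (fun b => c b * period_summand b (S m') n w) m') m').
      * intros b. apply integral_period_summand. lia.
      * intros t Ht. apply sum_n_ext. intros b. now rewrite period_summand_RtoC by (lia || exact Ht).
Qed.
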